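(* Let $p\ge 2$. There is an iterative algorithm for the $\ell_p$ regression problem $\min_{x\in\mathbb{R}^n\colon Ax=b}\|x\|_p$ that outputs $x$ with $Ax=b$ and $\|x\|_p\le(1+\epsilon)\min_{x'\colon Ax'=b}\|x'\|_p$, and that solves $O\left(p^{2}\log n\log\left(\frac{n}{\epsilon}\right)\right)$ subproblems, each of which makes $O\big(n^{\frac{p-2}{3p-2}}\big)$ calls to solve a linear system of the form $\widetilde{A}D\widetilde{A}^{\top}\phi=z$, where $D$ is an arbitrary non-negative diagonal matrix, $\widetilde{A}$ is a matrix obtained from $A$ by appending a single row, and $z$ is a vector obtained from the all-zero vector by appending a single non-zero coordinate.
   Context: The input to the $\ell_p$ regression problem is a matrix $A\in\mathbb{R}^{d\times n}$, a vector $b\in\mathbb{R}^d$ lying in the column span of $A$, and an accuracy parameter $\epsilon>0$. The goal is to find $x\in\mathbb{R}^n$ with $Ax=b$ and $\|x\|_p\le(1+\epsilon)\|x^*\|_p$, where $x^*$ is an optimal solution of $\min_{x\colon Ax=b}\|x\|_p$. *)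

(* Defs.v *)
From HB Require Import structures.
From mathcomp Require Import all_boot all_order all_algebra.
From mathcomp Require Import all_classical reals exp.
Set Implicit Arguments.
Unset Strict Implicit.
Unset Printing Implicit Defensive.
Import Order.TTheory GRing.Theory Num.Theory.
Local Open Scope ring_scope.

Section Regression.
Variable R : realType.

Definition lp_norm (p : R) n (x : 'cV[R]_n) : R :=
  (\sum_i `|x i 0| `^ p) `^ p^-1.

Definition in_col_span d n (A : 'M[R]_(d, n)) (b : 'cV[R]_d) : Prop :=
  exists x : 'cV[R]_n, A *m x = b.

Definition lp_optimal (p : R) d n (A : 'M[R]_(d, n)) (b : 'cV[R]_d)
    (xs : 'cV[R]_n) : Prop :=
  A *m xs = b /\ forall x, A *m x = b -> lp_norm p xs <= lp_norm p x.

Definition lp_approx_solution (p eps : R) d n (A : 'M[R]_(d, n))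
    (b : 'cV[R]_d) (x : 'cV[R]_n) : Prop :=
  A *m x = b /\
  exists2 xs, lp_optimal p A b xs & lp_norm p x <= (1 + eps) * lp_norm p xs.

(* Nothing is known about the answer to an inconsistent system, nor about which
   solution of a singular one is returned. *)
Definition linear_solver (solve : forall m, 'M[R]_m -> 'cV[R]_m -> 'cV[R]_m) :=
  forall m (M : 'M[R]_m) (z : 'cV[R]_m),
    (exists phi, M *m phi = z) -> M *m solve m M z = z.

End Regression.

(* Algorithms are while-programs over three banks of registers, holding reals,
   n-vectors and d-vectors. They are first-order syntax (rather than Rocq
   functions on reals, among which the exact minimizer itself can be found):
   apart from linear system solves, the data can only be accessed through the
   operations below, each of which takes time linear in the size of A. *)

Variant binop := OpAdd | OpSub | OpMul | OpDiv | OpPow | OpLe.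

Variant basic :=
| SConst (i c : nat)
| SLn (i j : nat)
| SOp (o : binop) (i j k : nat)
| NFill (i j : nat)
| NOp (o : binop) (i j k : nat)
| NSum (i j : nat)
| DFill (i j : nat)
| DOp (o : binop) (i j k : nat)
| DSum (i j : nat)
| MulA (i j : nat)
| MulAT (i j : nat).

(* The guard [i j] of If and While is "scalar i <= scalar j". *)
Inductive prog (I : Type) :=
| Skip
| Do of I
| Seq of prog I & prog I
| If (i j : nat) of prog I & prog I
| While (i j : nat) of prog I.

(* [Solve r w c u t] solves At *m D *m At^T *m phi = z where At is A with the
   n-vector r appended as last row, D is the diagonal matrix with diagonal the
   n-vector w, and z is 0 with the scalar c appended; the first d coordinates of
   phi are stored in the d-vector u and the last one in the scalar t. *)
Variant sub_instr :=
| SubBasic of basic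
| Solve (r w c u t : nat).

(* [LeastSquares u] stores in the d-vector u a solution of
   A *m A^T *m phi = b, so that A^T *m phi is the feasible point of least
   Euclidean norm. *)
Variant main_instr :=
| MainBasic of basic
| LeastSquares (u : nat)
| Subproblem of prog sub_instr.

Definition algorithm := prog main_instr.

Variant sub_event := SubOp | SolveCall.
Variant main_event := MainOp | LeastSquaresCall | SubRun of seq sub_event.

Definition is_sub_op e := if e is SubOp then true else false.
Definition is_solve_call e := if e is SolveCall then true else false.
Definition is_main_op e := if e is MainOp then true else false.
Definition is_least_squares_call e :=
  if e is LeastSquaresCall then true else false.

Definition subproblems (t : seq main_event) : seq (seq sub_event) :=
  pmap (fun e => if e is SubRun u then Some u else None) t.

Record state (R : realType) (n d : nat) := State {
  sreg : nat -> R;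
  nreg : nat -> 'cV[R]_n;
  dreg : nat -> 'cV[R]_d
}.

Section Semantics.
Variable R : realType.

Definition eval_binop (o : binop) (x y : R) : R :=
  match o with
  | OpAdd => x + y
  | OpSub => x - y
  | OpMul => x * y
  | OpDiv => x / y
  | OpPow => x `^ y
  | OpLe => (x <= y)%R%:R
  end.

Definition upd T (f : nat -> T) (i : nat) (x : T) : nat -> T :=
  fun k => if k == i then x else f k.

Variables n d : nat.
Notation state := (state R n d).

Definition set_s (s : state) i x := State (upd (sreg s) i x) (nreg s) (dreg s).
Definition set_n (s : state) i x := State (sreg s) (upd (nreg s) i x) (dreg s).
Definition set_d (s : state) i x := State (sreg s) (nreg s) (upd (dreg s) i x).

Section Exec.
Variables (I E : Type) (step : I -> state -> E -> state -> Prop).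

Inductive exec : prog I -> state -> seq E -> state -> Prop :=
| exec_Skip s : exec (Skip I) s [::] s
| exec_Do a s e s' : step a s e s' -> exec (Do a) s [:: e] s'
| exec_Seq c1 c2 s t1 s1 t2 s2 :
    exec c1 s t1 s1 -> exec c2 s1 t2 s2 -> exec (Seq c1 c2) s (t1 ++ t2) s2
| exec_IfT i j c1 c2 s t s' : sreg s i <= sreg s j ->
    exec c1 s t s' -> exec (If i j c1 c2) s t s'
| exec_IfF i j c1 c2 s t s' : sreg s j < sreg s i ->
    exec c2 s t s' -> exec (If i j c1 c2) s t s'
| exec_WhileT i j c s t1 s1 t2 s2 : sreg s i <= sreg s j ->
    exec c s t1 s1 -> exec (While i j c) s1 t2 s2 ->
    exec (While i j c) s (t1 ++ t2) s2
| exec_WhileF i j c s : sreg s j < sreg s i -> exec (While i j c) s [::] s.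

End Exec.

Variables (A : 'M[R]_(d, n)) (b : 'cV[R]_d).
Variable solve : forall m, 'M[R]_m -> 'cV[R]_m -> 'cV[R]_m.

Definition eval_basic (a : basic) (s : state) : state :=
  match a with
  | SConst i c => set_s s i c%:R
  | SLn i j => set_s s i (ln (sreg s j))
  | SOp o i j k => set_s s i (eval_binop o (sreg s j) (sreg s k))
  | NFill i j => set_n s i (const_mx (sreg s j))
  | NOp o i j k => set_n s i (map2_mx (eval_binop o) (nreg s j) (nreg s k))
  | NSum i j => set_s s i (\sum_k nreg s j k 0)
  | DFill i j => set_d s i (const_mx (sreg s j))
  | DOp o i j k => set_d s i (map2_mx (eval_binop o) (dreg s j) (dreg s k))
  | DSum i j => set_s s i (\sum_k dreg s j k 0)
  | MulA i j => set_d s i (A *m nreg s j)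
  | MulAT i j => set_n s i (A^T *m dreg s j)
  end.

Definition append_row (r : 'cV[R]_n) : 'M[R]_(d + 1, n) := col_mx A r^T.

Definition solve_call (r w : 'cV[R]_n) (c : R) : 'cV[R]_(d + 1) :=
  let At := append_row r in
  solve (At *m diag_mx w^T *m At^T) (col_mx 0 c%:M).

(* A Solve whose diagonal has a negative entry, or whose right-hand side is
   zero, has no execution. *)
Variant sub_step : sub_instr -> state -> sub_event -> state -> Prop :=
| step_SubBasic a s : sub_step (SubBasic a) s SubOp (eval_basic a s)
| step_Solve r w c u t s :
    (forall k, 0 <= nreg s w k 0) -> sreg s c != 0 ->
    let phi := solve_call (nreg s r) (nreg s w) (sreg s c) in
    sub_step (Solve r w c u t) s SolveCall
      (set_d (set_s s t (dsubmx phi 0 0)) u (usubmx phi)).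

Variant main_step : main_instr -> state -> main_event -> state -> Prop :=
| step_MainBasic a s : main_step (MainBasic a) s MainOp (eval_basic a s)
| step_LeastSquares u s :
    main_step (LeastSquares u) s LeastSquaresCall
      (set_d s u (solve (A *m A^T) b))
| step_Subproblem c s t s' :
    exec sub_step c s t s' -> main_step (Subproblem c) s (SubRun t) s'.

Definition initial_state (p eps : R) : state :=
  State (nth 0 [:: p; eps; n%:R; d%:R]) (fun=> 0)
        (fun i => if i == 0%N then b else 0).

Definition run (p eps : R) (alg : algorithm) (t : seq main_event)
    (x : 'cV[R]_n) : Prop :=
  exists2 s, exec main_step alg (initial_state p eps) t s & nreg s 0%N = x.

End Semantics.

(* Main.v *)
Require Import Defs.
From HB Require Import structures.
From mathcomp Require Import all_boot all_order all_algebra.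
From mathcomp Require Import all_classical reals topology normedtype sequences.
From mathcomp Require Import derive exp.
From mathcomp Require Import ring lra.
Set Implicit Arguments.
Unset Strict Implicit.
Unset Printing Implicit Defensive.
Import Order.TTheory GRing.Theory Num.Theory.
Import numFieldNormedType.Exports.
Local Open Scope ring_scope.

(** Iterative refinement. Let f x = sum |x_i|^p, and let nu bound the gap
    f x - min f. If the gap exceeds nu/2, then the step D towards the optimum,
    suitably shortened, satisfies A D = 0, <grad f x, D> = - nu/2,
    sum |x_i|^(p-2) D_i^2 = O(nu/p) and ||D||_p = O(nu^(1/p)). Finding such a D up
    to constant factors (O(q) for the norm) and moving by D / O(p q) decreases f by
    nu / O(p q); when no D exists, nu is halved.

    The residual problem is solved by multiplicative weights with width reduction,
    in the norm of exponent q, the projection of p onto [2 + 1/L, 2 + L] with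
    L = 1 + ln n: on n coordinates this changes norms by constant factors only, and
    both q and 1/(q-2) are O(ln n). With s_i > 0 of q-norm about 1, let y minimize
    the energy sum (w_i + s_i^(q-2)) y_i^2 over the feasible directions; this is one
    linear system. If the energy exceeds 10 there is no feasible D. If
    sum |y_i|^q <= width, a multiple of |y| is added to s and y to a running sum,
    which after T = n^((q-2)/(3q-2)) such rounds gives D. Otherwise s_i is increased
    by a factor 1 + 1/q on the congested coordinates rho s_i <= |y_i|, which
    increases the energy by at least (q-2)/(2(q+1)T), hence happens O(T/(q-2))
    times. The increase of sum s_i^q is paid for by the rounds (2/T each) and by the
    energy (a fifth of its increase).

    All solves are executed by one flat loop, cut into subproblems of floor T
    iterations; a real-valued measure decreases by 1 at each iteration. *)

(** * Estimates for real powers *)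

Section PowR.
Variable R : realType.
Implicit Types a b p q r s t x y z : R.

(** The exponent of n balances two costs. A round is allowed when the q-th power sum of y is at most
    [width], because then its higher-order effect on the potential is at most 1/T. Otherwise the
    congested coordinates have squared norm at least T^(2(q-1)/q); as every s_i is at least
    n^(-1/q), they carry energy n^(-(q-2)/q) T^(2(q-1)/q), which equals 1/T exactly for T =
    n^((q-2)/(3q-2)).

    The obstacle is that one residual problem may take T/(q-2) solves, with q - 2 as small as 1/L,
    while a subproblem may make only O(T). Cutting the loop every floor T iterations, wherever
    residual problems begin and end, moves this factor into the number of subproblems. There a
    refinement costs O(p L) subproblems in the amortized sense, and nu is halved O(p log(n/eps))
    times.

    Neither the optimal value nor the feasibility of a residual problem is known to the program. It
    therefore tests every vector obtained from the solver, and the lower bound [e] on the energy of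
    all directions exists only in the analysis. *)

Lemma powR_lerl r a b : 0 <= r -> 0 <= a -> a <= b -> a `^ r <= b `^ r.
Proof.
move=> r0 a0 ab; apply: ge0_ler_powR; rewrite ?nnegrE //.
exact: le_trans ab.
Qed.

Lemma powR_sqr a : 0 <= a -> a `^ 2 = a ^+ 2.
Proof. by move=> a0; rewrite (powR_mulrn 2). Qed.

Lemma normr_sqr x : `|x| ^+ 2 = x ^+ 2.
Proof. by rewrite real_normK ?num_real. Qed.

Lemma powR_split2 a p : 2 <= p -> a `^ p = a `^ (p - 2) * a `^ 2.
Proof.
move=> p2; rewrite -powRD ?subrK//; apply/implyP => /eqP; lra.
Qed.

Lemma powR_inv_root a p : 0 < p -> 0 <= a -> (a `^ p^-1) `^ p = a.
Proof. by move=> p0 a0; rewrite -powRrM mulVf ?gt_eqF// powRr1. Qed.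

(** Young's inequality for the product of y and 1, with exponents r and r / (r - 1). *)
Lemma bernoulli_powR y r : 0 <= y -> 1 <= r -> 1 + r * (y - 1) <= y `^ r.
Proof.
move=> y0; rewrite le_eqVlt => /predU1P[<-|r1].
  by rewrite powRr1//; lra.
have r0 : 0 < r by lra.
have r'0 : 0 < r / (r - 1) by apply: divr_gt0; lra.
have := @conjugate_powR R y 1 r (r / (r - 1)) y0 ler01 r0 r'0.
rewrite powR1 /= mulr1 => /(_ _) H.
have {H} : y <= y `^ r / r + 1 / (r / (r - 1)).
  by apply: H; field; lra.
have -> : 1 / (r / (r - 1)) = (r - 1) / r by field; lra.
rewrite -mulrDl ler_pdivlMr//; lra.
Qed.

Lemma powR_le_expR z r : -1 < z -> 0 <= r -> (1 + z) `^ r <= expR (r * z).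
Proof.
move=> z1 r0; rewrite /powR ifF; last by apply/negbTE; lra.
by rewrite ler_expR ler_wpM2l// le_ln1Dx.
Qed.

Lemma expR_le_quadratic z : `|z| <= 2^-1 -> expR z <= 1 + z + 2 * z ^+ 2.
Proof.
move=> zh; have [z1 z2] : - 2^-1 <= z /\ z <= 2^-1 by apply/andP; rewrite -ler_norml.
have := expR_ge1Dx (- z); rewrite expRN => h.
have : expR z * (1 - z) <= 1.
  by rewrite mulrC -ler_pdivlMr ?expR_gt0// mul1r.
have := expR_gt0 z => e0 h2.
have h3 : 1 <= (1 + z + 2 * z ^+ 2) * (1 - z).
  have -> : (1 + z + 2 * z ^+ 2) * (1 - z) = 1 + z ^+ 2 * (1 - 2 * z) by ring.
  have : 0 <= z ^+ 2 * (1 - 2 * z) by apply: mulr_ge0; [exact: sqr_ge0|lra].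
  lra.
have z3 : 0 < 1 - z by lra.
rewrite -(ler_pM2r z3); lra.
Qed.

Lemma expR_half_le2 : expR (2^-1 : R) <= 2.
Proof.
have /expR_le_quadratic : `|2^-1 : R| <= 2^-1 by rewrite ger0_norm ?invr_ge0.
lra.
Qed.

Lemma expR1_le4 : expR (1 : R) <= 4.
Proof.
have -> : (1 : R) = 2^-1 + 2^-1 by lra.
rewrite expRD; have := expR_half_le2; have := expR_gt0 (2^-1 : R); nra.
Qed.

(** Bernoulli for (1 + t)^2 with exponent p/2 gives the quadratic coefficient p/2. For |t| <= 4,
    half of it pays for the p-th power term; beyond, a quarter of |1 + t|^p does, because |1 + t| >=
    3/4 |t|. *)
Lemma powR_1D_lower p t : 2 <= p ->
  1 + p * t + p / 4 * t ^+ 2 + (`|t| / 4) `^ p <= `|1 + t| `^ p.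
Proof.
move=> p2; have p0 : 0 <= p by lra.
have P0 : 1 + p * t + p / 2 * t ^+ 2 <= `|1 + t| `^ p.
  have -> : p = 2 * (p / 2) by lra.
  rewrite powRrM powR_sqr// normr_sqr.
  have hp : 1 <= p / 2 by lra.
  apply: le_trans (bernoulli_powR (sqr_ge0 _) hp).
  by have -> : 1 + 2 * (p / 2) * t + 2 * (p / 2) / 2 * t ^+ 2 =
    1 + p / 2 * ((1 + t) ^+ 2 - 1) by field.
have [t4|t4] := leP `|t| 4.
  have h : (`|t| / 4) `^ p <= (`|t| / 4) ^+ 2.
    rewrite -powR_sqr; last by rewrite divr_ge0.
    have [->|t0] := eqVneq t 0.
      by rewrite normr0 mul0r !powR0//; lra.
    apply: ger_powR => //; rewrite divr_gt0 ?normr_gt0//= ler_pdivrMr//; lra.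
  have : (`|t| / 4) ^+ 2 <= p / 4 * t ^+ 2.
    rewrite exprMn normr_sqr; have := sqr_ge0 t; nra.
  lra.
have h1 : (3 / 4 * `|t|) `^ p <= `|1 + t| `^ p.
  apply: powR_lerl => //; first by rewrite mulr_ge0//; lra.
  have : `|t| <= `|1 + t| + 1.
    by have := ler_normB (1 + t) 1; rewrite normr1 addrAC subrr add0r.
  lra.
have h2 : (`|t| / 4) `^ p <= 4^-1 * (3 / 4 * `|t|) `^ p.
  have -> : 3 / 4 * `|t| = 3 * (`|t| / 4) by field.
  rewrite [X in _ <= _ * X]powRM ?divr_ge0// mulrA ler_peMl ?powR_ge0//.
  have : (3 : R) `^ 2 <= 3 `^ p by rewrite ler_powR//; lra.
  rewrite powR_sqr//; lra.
have h3 : 1 + p * t + p / 4 * t ^+ 2 <= 3 / 4 * (1 + p * t + p / 2 * t ^+ 2).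
  rewrite -(normr_sqr t); have := ler_norm t.
  have : 1 <= `|t| by lra.
  have : 4 * `|t| <= `|t| ^+ 2 by rewrite expr2; apply: ler_wpM2r => //; lra.
  nra.
lra.
Qed.

Lemma powR_normM x y p : `|x * y| `^ p = `|x| `^ p * `|y| `^ p.
Proof. by rewrite normrM powRM. Qed.

Lemma powR_sub2_sqr x p : 2 <= p -> `|x| `^ (p - 2) * x ^+ 2 = `|x| `^ p.
Proof. by move=> p2; rewrite (powR_split2 _ p2) powR_sqr// normr_sqr. Qed.

Lemma powR_norm_lower x t p : 2 <= p ->
  `|x| `^ p + p * (`|x| `^ (p - 2) * x) * t + p / 4 * (`|x| `^ (p - 2) * t ^+ 2)
    + (`|t| / 4) `^ p <= `|x + t| `^ p.
Proof.
move=> p2; have [->|x0] := eqVneq x 0.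
  rewrite normr0 add0r mulr0 mulr0 mul0r addr0 powR0; last lra.
  rewrite add0r.
  have h : (`|t| / 4) `^ p <= 8^-1 * `|t| `^ p.
    rewrite powRM ?invr_ge0// mulrC ler_wpM2r ?powR_ge0//.
    have : (4^-1 : R) `^ p <= 4^-1 `^ 2 by rewrite ger_powR//; lra.
    rewrite powR_sqr//; lra.
  have [->|pn2] := eqVneq p 2.
    by rewrite subrr powRr0 mul1r; move: h; have [->|] := eqVneq p 2;
       rewrite ?powR_sqr ?divr_ge0// ?exprMn normr_sqr => ? ; have := sqr_ge0 t; lra.
  rewrite powR0; last by rewrite subr_eq0.
  by rewrite mul0r mulr0 add0r; move: h; have := powR_ge0 `|t| p; lra.
pose u := t / x.
have tE : t = x * u by rewrite /u; field.
rewrite tE; have -> : x + x * u = x * (1 + u) by ring.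
rewrite powR_normM; have h := powR_1D_lower u p2.
apply: (le_trans _ (ler_wpM2l (powR_ge0 `|x| p) h)).
have -> : `|x * u| / 4 = `|x| * (`|u| / 4) by rewrite normrM mulrA.
rewrite [X in _ + X <= _]powRM ?divr_ge0//.
rewrite -(powR_sub2_sqr x p2); set w := `|x| `^ (p - 2).
by set v := (_ / 4) `^ p; rewrite le_eqVlt; apply/orP; left; apply/eqP; ring.
Qed.

(** The threshold 1/(2p) separates the range where exp (p t) has a quadratic bound from the range
    where |1 + t| <= (2p + 1) |t|. The factor 2p + 1 is one reason why [step_scale] is proportional
    to p. *)
Lemma powR_1D_upper p t : 2 <= p ->
  `|1 + t| `^ p <= 1 + p * t + 2 * p ^+ 2 * t ^+ 2 + ((2 * p + 1) * `|t|) `^ p.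
Proof.
move=> p2; have [tp|tp] := leP `|t| (2 * p)^-1.
  have pt : `|p * t| <= 2^-1.
    rewrite normrM ger0_norm; last lra.
    have -> : (2^-1 : R) = p * (2 * p)^-1 by field; lra.
    by rewrite ler_wpM2l//; lra.
  have t1 : `|t| < 1.
    apply: (le_lt_trans tp); rewrite invf_lt1; lra.
  move: t1; rewrite ltr_norml => /andP[t1 t2].
  have := expR_le_quadratic pt; have := @powR_le_expR t p t1.
  rewrite ger0_norm; last lra.
  move=> /(_ ltac:(lra)); have := powR_ge0 ((2 * p + 1) * `|t|) p.
  rewrite exprMn; lra.
have pt : 1 < 2 * p * `|t|.
  by rewrite mulrC -ltr_pdivrMr ?div1r//; lra.
have h1 : `|1 + t| `^ p <= ((2 * p + 1) * `|t|) `^ p.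
  apply: powR_lerl => //; first lra.
  apply: (le_trans (ler_normD _ _)); rewrite normr1; lra.
have h2 : 0 <= 1 + p * t + 2 * p ^+ 2 * t ^+ 2.
  have : 0 <= (1 + p * t) ^+ 2 by exact: sqr_ge0.
  have : 0 <= (p * t) ^+ 2 by exact: sqr_ge0.
  nra.
lra.
Qed.

Lemma powR_norm_upper x t p : 2 <= p ->
  `|x + t| `^ p <=
  `|x| `^ p + p * (`|x| `^ (p - 2) * x) * t
    + 2 * p ^+ 2 * (`|x| `^ (p - 2) * t ^+ 2) + ((2 * p + 1) * `|t|) `^ p.
Proof.
move=> p2; have [->|x0] := eqVneq x 0.
  rewrite normr0 add0r mulr0 mulr0 mul0r addr0.
  apply: (@le_trans _ _ (((2 * p + 1) * `|t|) `^ p)).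
    by apply: powR_lerl => //; [lra|rewrite ler_peMl//; lra].
  rewrite lerDr addr_ge0 ?powR_ge0//; do 2?apply: mulr_ge0 => //; rewrite ?powR_ge0 ?sqr_ge0//; lra.
pose u := t / x.
have tE : t = x * u by rewrite /u; field.
rewrite tE; have -> : x + x * u = x * (1 + u) by ring.
rewrite powR_normM; have h := powR_1D_upper u p2.
apply: (le_trans (ler_wpM2l (powR_ge0 `|x| p) h)).
have -> : (2 * p + 1) * `|x * u| = `|x| * ((2 * p + 1) * `|u|) by rewrite normrM; ring.
rewrite [X in _ <= _ + X]powRM ?mulr_ge0//; last lra.
rewrite -(powR_sub2_sqr x p2); set w := `|x| `^ (p - 2).
by set v := (_ * `|u|) `^ p; rewrite le_eqVlt; apply/orP; left; apply/eqP; ring.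
Qed.

Lemma powRB_mul s q : 0 < s -> s `^ (q - 1) * s = s `^ q.
Proof. by move=> s0; rewrite -{2}(powRr1 (ltW s0)) -powRD ?subrK// (gt_eqF s0) implybT. Qed.

Lemma powR_add_upper s t q : 0 < s -> 2 <= q -> 0 <= t ->
  (s + t) `^ q <= s `^ q + 2 * q * (s `^ (q - 1) * t) + ((2 * q + 1) * t) `^ q.
Proof.
move=> s0 q2 t0; pose u := t / s; have u0 : 0 <= u by rewrite divr_ge0// ltW.
have tE : t = s * u by rewrite /u; field; lra.
have h : (1 + u) `^ q <= 1 + 2 * q * u + ((2 * q + 1) * u) `^ q.
  have [uq|uq] := leP u (2 * q)^-1.
    have qu : q * u <= 2^-1.
      have -> : (2^-1 : R) = q * (2 * q)^-1 by field; lra.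
      by rewrite ler_wpM2l//; lra.
    have qu0 : 0 <= q * u by rewrite mulr_ge0//; lra.
    have := expR_le_quadratic (z := q * u); rewrite ger0_norm// => /(_ qu).
    have /powR_le_expR : -1 < u by lra.
    move=> /(_ q ltac:(lra)); have := powR_ge0 ((2 * q + 1) * u) q.
    nra.
  have qu : 1 < 2 * q * u by rewrite mulrC -ltr_pdivrMr ?div1r//; lra.
  have : (1 + u) `^ q <= ((2 * q + 1) * u) `^ q.
    by apply: powR_lerl; lra.
  have : 0 <= q * u by rewrite mulr_ge0//; lra.
  nra.
rewrite tE; have -> : s + s * u = s * (1 + u) by ring.
rewrite powRM ?(ltW s0)//; last lra.
apply: (le_trans (ler_wpM2l (powR_ge0 s q) h)).
have -> : (2 * q + 1) * (s * u) = s * ((2 * q + 1) * u) by ring.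
rewrite [X in _ <= _ + X]powRM ?(ltW s0)//; last by rewrite mulr_ge0//; lra.
rewrite -(powRB_mul q s0); set v := s `^ (q - 1).
by rewrite le_eqVlt; apply/orP; left; apply/eqP; ring.
Qed.

End PowR.

(** * Energy, weights and width reduction *)

Section PowerSums.
Variables (R : realType) (n : nat).
Implicit Types (x y s : 'I_n -> R) (P : pred 'I_n).

Lemma sum_powR_le_sqr P y (q : R) : 2 <= q ->
  \sum_(i | P i) `|y i| `^ q <= (\sum_(i | P i) y i ^+ 2) `^ (q / 2).
Proof.
move=> q2; set Y := \sum_(i | P i) y i ^+ 2.
have Y0 : 0 <= Y by apply: sumr_ge0 => i _; exact: sqr_ge0.
have -> : Y `^ (q / 2) = Y * Y `^ (q / 2 - 1).
  by rewrite mulr_powRB1//; lra.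
rewrite {1}/Y mulr_suml; apply: ler_sum => i Pi.
rewrite -(powR_sub2_sqr _ q2) mulrC ler_wpM2l ?sqr_ge0//.
have -> : q - 2 = 2 * (q / 2 - 1) by lra.
rewrite powRrM powR_sqr// normr_sqr; apply: powR_lerl; rewrite ?sqr_ge0//; first lra.
rewrite /Y (bigD1 i)//= lerDl; apply: sumr_ge0 => j _; exact: sqr_ge0.
Qed.

Lemma norm_le_root_sum_powR y (p : R) i : 0 < p ->
  `|y i| <= (\sum_j `|y j| `^ p) `^ p^-1.
Proof.
move=> p0; have -> : `|y i| = (`|y i| `^ p) `^ p^-1.
  by rewrite -powRrM divff ?gt_eqF// powRr1.
apply: powR_lerl; rewrite ?powR_ge0 ?invr_ge0 ?(ltW p0)//.
by rewrite (bigD1 i)//= lerDl; apply: sumr_ge0 => j _; exact: powR_ge0.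
Qed.

Lemma norm_le1_sum_powR y (p : R) i : 0 < p ->
  \sum_j `|y j| `^ p <= 1 -> `|y i| <= 1.
Proof.
move=> p0 h; apply: le_trans (norm_le_root_sum_powR y i p0) _.
have <- : (1 : R) `^ p^-1 = 1 by rewrite powR1.
apply: powR_lerl => //; first by rewrite invr_ge0 ltW.
by apply: sumr_ge0 => j _; exact: powR_ge0.
Qed.

Lemma sum_powR_scale (c : R) y (p : R) : 0 <= c ->
  \sum_i `|c * y i| `^ p = c `^ p * \sum_i `|y i| `^ p.
Proof.
move=> c0; rewrite mulr_sumr; apply: eq_bigr => i _.
by rewrite powR_normM ger0_norm.
Qed.

End PowerSums.

Section Energy.
Variables (R : realType) (n : nat).
Implicit Types (u v y z : 'I_n -> R).

Definition energy u y := \sum_i u i * y i ^+ 2.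

(* The optimality condition sum u y z = energy u y makes the completed square
   v z^2 >= 2 u y z - u^2 y^2 / v sum up to the claim. *)
Lemma energy_increase u v y z :
  (forall i, 0 < v i) -> \sum_i u i * y i * z i = energy u y ->
  energy u y + \sum_i u i / v i * (v i - u i) * y i ^+ 2 <= energy v z.
Proof.
move=> v0 oyz.
have h i : 2 * (u i * y i * z i) - u i ^+ 2 / v i * y i ^+ 2 <= v i * z i ^+ 2.
  rewrite -subr_ge0.
  have -> : v i * z i ^+ 2 - (2 * (u i * y i * z i) - u i ^+ 2 / v i * y i ^+ 2) =
    (v i * z i - u i * y i) ^+ 2 / v i.
    by field; rewrite gt_eqF.
  by rewrite divr_ge0 ?sqr_ge0// ltW.
apply: (le_trans _ (ler_sum _ (fun i _ => h i))).
rewrite sumrB -mulr_sumr oyz.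
have -> : \sum_i u i / v i * (v i - u i) * y i ^+ 2 =
    energy u y - \sum_i u i ^+ 2 / v i * y i ^+ 2.
  rewrite /energy -sumrB; apply: eq_bigr => i _.
  by field; rewrite gt_eqF.
lra.
Qed.

Lemma energy_min u y z : (forall i, 0 < u i) ->
  \sum_i u i * y i * z i = energy u y -> energy u y <= energy u z.
Proof.
move=> u0 /(energy_increase u0); rewrite big1 ?addr0// => i _.
by rewrite subrr mulr0 mul0r.
Qed.

End Energy.

(** * Effect of a round and of a boost on potential and weights *)

Section Weights.
Variables (R : realType) (n : nat) (q : R).
Implicit Types (w s y : 'I_n -> R).

Definition weight w s i : R := w i + s i `^ (q - 2).
Definition potential s : R := \sum_i s i `^ q.

Lemma weight_gt0 w s : (forall i, 0 <= w i) -> (forall i, 0 < s i) ->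
  forall i, 0 < weight w s i.
Proof. by move=> w0 s0 i; rewrite /weight ltr_wpDl ?powR_gt0. Qed.

(** Coordinatewise, s^(q-2) y^2 is at most the q-th power of the larger of s and |y|. A solution of
    the residual problem thus bounds the least energy in terms of the potential. *)
Lemma weight_sum_le w s y : 2 < q -> (forall i, 0 < s i) ->
  energy (weight w s) y <= energy w y + potential s + \sum_i `|y i| `^ q.
Proof.
move=> q2 s0; rewrite /energy /potential -!big_split/=; apply: ler_sum => i _.
rewrite /weight mulrDl -addrA lerD2l.
have [sy|ys] := leP (s i) `|y i|.
  apply: (@le_trans _ _ (`|y i| `^ q)); last by rewrite lerDr powR_ge0.
  rewrite -[leRHS]powR_sub2_sqr ?ler_wpM2r ?sqr_ge0//; last exact: ltW.
  by apply: powR_lerl => //; [lra|exact: ltW].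
apply: (@le_trans _ _ (s i `^ q)); last by rewrite lerDl powR_ge0.
rewrite (powR_split2 (s i) (ltW q2)) ler_wpM2l ?powR_ge0// powR_sqr; last exact: ltW.
by rewrite -normr_sqr lerXn2r ?nnegrE// ltW.
Qed.

(** The first-order growth is at most q a (potential + energy) <= 15 q a by AM-GM, less than 1/T.
    The 45 is 3 * 15: as 2q + 1 <= 3q, the remainder is at most (15 T)^(-q) times the width bound
    T^(q-1) 15^q, which is 1/T. *)
Lemma flow_potential w s y (T : R) : 2 < q -> 1 <= T ->
  (forall i, 0 <= w i) -> (forall i, 0 < s i) ->
  potential s <= 5 -> energy (weight w s) y <= 10 ->
  \sum_i `|y i| `^ q <= T `^ (q - 1) * 15 `^ q ->
  potential (fun i => s i + (45 * q * T)^-1 * `|y i|) <= potential s + 2 / T.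
Proof.
move=> q2 T1 w0 s0 P5 E10 tau; set a := (45 * q * T)^-1.
have T0 : 0 < T by lra.
have a0 : 0 < a by rewrite invr_gt0 !mulr_gt0//; lra.
have h i : (s i + a * `|y i|) `^ q <= s i `^ q +
    q * a * (s i `^ q + weight w s i * y i ^+ 2) + (15 * T)^-1 `^ q * `|y i| `^ q.
  have := @powR_add_upper R (s i) (a * `|y i|) q (s0 i) (ltW q2).
  move=> /(_ (mulr_ge0 (ltW a0) (normr_ge0 _)))/le_trans; apply.
  apply: lerD; last first.
    rewrite -powRM ?invr_ge0 ?mulr_ge0//; last lra.
    apply: powR_lerl; first lra.
      by rewrite !mulr_ge0 ?(ltW a0)//; lra.
    rewrite mulrA ler_wpM2r//.
    have -> : (15 * T)^-1 = 3 * q * a by rewrite /a; field; lra.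
    by rewrite ler_wpM2r ?(ltW a0)//; lra.
  rewrite lerD2l.
  have -> : 2 * q * (s i `^ (q - 1) * (a * `|y i|)) =
            q * a * (2 * (s i `^ (q - 1) * `|y i|)) by ring.
  rewrite ler_wpM2l//; first by rewrite mulr_ge0// ?(ltW a0)//; lra.
  apply: (@le_trans _ _ (s i `^ q + s i `^ (q - 2) * y i ^+ 2)); last first.
    by rewrite lerD2l ler_wpM2r ?sqr_ge0// /weight lerDr.
  have -> : s i `^ (q - 1) = s i `^ (q - 2) * s i.
    have -> : q - 2 = (q - 1) - 1 by lra.
    by rewrite powRB_mul.
  rewrite (powR_split2 (s i) (ltW q2)) powR_sqr ?(ltW (s0 i))// -(normr_sqr (y i)).
  have := powR_ge0 (s i) (q - 2); set v := s i `^ (q - 2) => v0.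
  have := mulr_ge0 v0 (sqr_ge0 (s i - `|y i|)); nra.
apply: (le_trans (ler_sum _ (fun i _ => h i))).
rewrite !big_split/= -!mulr_sumr big_split/=.
rewrite -/(potential s) -/(energy _ y) -addrA lerD2l.
have -> : 2 / T = q * a * 45 + T^-1 by rewrite /a; field; lra.
apply: lerD; first by rewrite ler_wpM2l ?mulr_ge0// ?(ltW a0)//; lra.
apply: (@le_trans _ _ ((15 * T)^-1 `^ q * (T `^ (q - 1) * 15 `^ q))).
  by rewrite ler_wpM2l ?powR_ge0.
have TqE : T `^ (q - 1) = T^-1 * T `^ q.
  by rewrite -(powRB_mul q T0); field; lra.
have one : (15 * T)^-1 `^ q * (T `^ q * 15 `^ q) = 1.
  rewrite -!powRM ?mulr_ge0 ?invr_ge0//; try lra.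
  by rewrite [T * 15]mulrC mulVf ?powR1//; lra.
by rewrite TqE -mulrA mulrCA one mulr1.
Qed.

(** The condition is a real factor 0 or 1, as produced by the coordinatewise [OpLe], since vector
    operations cannot branch. *)
Definition boost (rho : R) s y i : R := s i * (1 + (rho * s i <= `|y i|)%R%:R / q).

Lemma boost_ge rho s y i : 2 < q -> 0 < s i -> s i <= boost rho s y i.
Proof.
move=> q2 s0; rewrite /boost ler_peMr ?(ltW s0)// lerDl divr_ge0//; lra.
Qed.

Lemma boost_potential rho s y : 2 < q -> (forall i, 0 < s i) ->
  potential (boost rho s y) <=
  potential s + 3 * \sum_(i | rho * s i <= `|y i|) s i `^ q.
Proof.
move=> q2 s0; rewrite /potential [X in _ + _ * X]big_mkcond mulr_sumr -big_split/=.
apply: ler_sum => i _; rewrite /boost; case: ifP => _; last first.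
  by rewrite mul0r addr0 mulr1 mulr0 addr0.
rewrite mul1r powRM ?(ltW (s0 i))//; last by rewrite addr_ge0// invr_ge0; lra.
have : (1 + q^-1) `^ q <= 4.
  apply: le_trans (@expR1_le4 R).
  have := @powR_le_expR R q^-1 q; rewrite mulfV; last lra.
  apply; last lra.
  by apply: (@lt_trans _ _ 0); [lra|rewrite invr_gt0; lra].
have := powR_ge0 (s i) q; nra.
Qed.

(** Since ln (1 + 1/q) >= 1/(q+1), the power is at least 1 + (q-2)/(q+1). The gain vanishes linearly
    as q tends to 2, hence the lower cutoff in [inner_exp]. *)
Lemma boost_gain_rate : 2 < q ->
  (q - 2) / (2 * (q + 1)) <= 1 - ((1 + q^-1) `^ (q - 2))^-1.
Proof.
move=> q2.
have qV : 0 < q^-1 by rewrite invr_gt0; lra.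
set z := (q - 2) / (q + 1).
have z0 : 0 < z by rewrite divr_gt0//; lra.
have z1 : z <= 1 by rewrite ler_pdivrMr; lra.
have bz : 1 + z <= (1 + q^-1) `^ (q - 2).
  rewrite /powR ifF; last by apply/negbTE; lra.
  apply: le_trans (expR_ge1Dx _); rewrite lerD2l /z ler_wpM2l//; first lra.
  have -> : 1 + q^-1 = (1 - (q + 1)^-1)^-1 by field; lra.
  rewrite lnV; last first.
    rewrite posrE subr_gt0 invf_lt1; lra.
  rewrite lerNr; apply: le_ln1Dx; rewrite ltrNr opprK invf_lt1; lra.
have -> : (q - 2) / (2 * (q + 1)) = z / 2 by rewrite /z; field; lra.
apply: (@le_trans _ _ (1 - (1 + z)^-1)).
  have -> : 1 - (1 + z)^-1 = z / (1 + z) by field; lra.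
  by rewrite ler_wpM2l ?(ltW z0)// lef_pV2 ?posrE; lra.
by rewrite lerD2l lerN2 lef_pV2 ?posrE ?powR_gt0; lra.
Qed.

(** With r = s^(q-2), the weight w + r becomes w + r b. The factor multiplying y^2 is at least (1 -
    1/b) r, because (w + r) b >= w + r b. *)
Lemma boost_weight_gain w rho s y i : 2 < q -> (forall i, 0 <= w i) -> (forall i, 0 < s i) ->
  (if rho * s i <= `|y i| then
     (q - 2) / (2 * (q + 1)) * (s i `^ (q - 2) * y i ^+ 2) else 0)
  <= weight w s i / weight w (boost rho s y) i *
     (weight w (boost rho s y) i - weight w s i) * y i ^+ 2.
Proof.
move=> q2 w0 s0; case: ifP => h; last first.
  by rewrite {3}/weight /boost h mul0r addr0 mulr1 subrr mulr0 mul0r.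
rewrite mulrA ler_wpM2r ?sqr_ge0//.
have qV : 0 < q^-1 by rewrite invr_gt0; lra.
set b := (1 + q^-1) `^ (q - 2).
have b1 : 1 <= b.
  by rewrite -[leLHS](powRr0 (1 + q^-1)) ler_powR; lra.
have wE : weight w (boost rho s y) i = w i + s i `^ (q - 2) * b.
  by rewrite /weight /boost h mul1r powRM ?(ltW (s0 i))//; lra.
have r0 : 0 < s i `^ (q - 2) by rewrite powR_gt0.
rewrite wE {2}/weight; set r := s i `^ (q - 2) in r0 *.
have -> : weight w s i / (w i + r * b) * (w i + r * b - (w i + r)) =
  (weight w s i * b / (w i + r * b)) * ((1 - b^-1) * r).
  rewrite /weight -/r; field; apply/andP; split; first by rewrite gt_eqF//; lra.
  by rewrite gt_eqF// ltr_wpDl// mulr_gt0//; lra.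
have g := boost_gain_rate q2; rewrite -/b in g.
have c0 : 0 <= (q - 2) / (2 * (q + 1)) by rewrite divr_ge0//; lra.
apply: (@le_trans _ _ ((1 - b^-1) * r)); first by rewrite ler_wpM2r// ltW.
rewrite ler_peMl//; first by rewrite mulr_ge0// ?(ltW r0)//; lra.
rewrite ler_pdivlMr; last by rewrite ltr_wpDl// mulr_gt0//; lra.
rewrite mul1r /weight -/r mulrDl lerD2r; have := w0 i; nra.
Qed.

End Weights.

(** * Width reduction and the choice of its parameters *)

Section WidthReduction.
Variables (R : realType) (n : nat) (q : R).
Implicit Types (w s y z : 'I_n -> R).

Definition rounds : R := n%:R `^ ((q - 2) / (3 * q - 2)).
Definition width : R := rounds `^ (q - 1) * 15 `^ q.
(** Chosen so that 3 s^q is one fifth of (q-2)/(2(q+1)) s^(q-2) (congestion s)^2: on a congested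
    coordinate the energy gain pays five times for the growth of the potential. *)
Definition congestion : R := (30 * (q + 1) / (q - 2)) `^ 2^-1.
Definition min_gain : R := (q - 2) / (2 * (q + 1)) / rounds.

Lemma rounds_ge1 : 2 < q -> (0 < n)%N -> 1 <= rounds.
Proof.
move=> q2 n0; rewrite /rounds -[leLHS](powRr0 n%:R) ler_powR ?ler1n//.
by rewrite divr_ge0//; lra.
Qed.

Lemma congestion_sqr : 2 < q -> congestion ^+ 2 = 30 * (q + 1) / (q - 2).
Proof.
move=> q2; have h : 0 <= 30 * (q + 1) / (q - 2) by rewrite divr_ge0//; lra.
rewrite -powR_sqr ?powR_ge0// -powRrM; have -> : 2^-1 * 2 = 1 :> R by field.
by rewrite powRr1.
Qed.

(** Uncongested coordinates contribute at most 10 congestion^(q-2) to the q-th power sum; the factor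
    20 makes this at most half of 15^q. The power of (q+1)/(q-2) stays below exp (3/2) however close
    q is to 2. *)
Lemma congestion_powR : 2 < q -> 20 * congestion `^ (q - 2) <= 15 `^ q.
Proof.
move=> q2; have h : 0 <= (q + 1) / (q - 2) by rewrite divr_ge0//; lra.
have h1 : (1 + 3 / (q - 2)) `^ (2^-1 * (q - 2)) <= 8.
  have : 0 < 3 / (q - 2) by rewrite divr_gt0//; lra.
  move=> h0; apply: (@le_trans _ _ (expR (2^-1 * (q - 2) * (3 / (q - 2))))).
    by apply: powR_le_expR; [lra|rewrite mulr_ge0//; lra].
  have -> : 2^-1 * (q - 2) * (3 / (q - 2)) = 2^-1 + 2^-1 + 2^-1 :> R.
    by field; lra.
  rewrite !expRD; have := @expR_half_le2 R; have := expR_gt0 (2^-1 : R).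
  set e := expR _ => e0 e2.
  have ee : e * e <= 4 by nra.
  have : 0 <= e * e by nra.
  nra.
rewrite /congestion -powRrM -mulrA powRM//.
have -> : (q + 1) / (q - 2) = 1 + 3 / (q - 2) by field; lra.
have h2 : (30 : R) `^ (2^-1 * (q - 2)) <= 15 `^ (q - 2).
  have -> : (15 : R) `^ (q - 2) = 225 `^ (2^-1 * (q - 2)).
    have -> : (225 : R) = 15 `^ 2 by rewrite powR_sqr//; lra.
    by rewrite -powRrM; congr (_ `^ _); field.
  by apply: powR_lerl => //; lra.
rewrite (powR_split2 15 (ltW q2)) powR_sqr//.
have := powR_ge0 (30 : R) (2^-1 * (q - 2)).
have := powR_ge0 (1 + 3 / (q - 2)) (2^-1 * (q - 2)).
move: h1 h2; set x1 := (1 + _) `^ _; set x2 := 30 `^ _; set x3 := 15 `^ _.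
move=> h1 h2 x10 x20.
have : x2 * x1 <= x3 * 8 by apply: ler_pM.
nra.
Qed.

(** The congested coordinates alone have q-th power sum at least T^(q-1). Passing to squares by
    [sum_powR_le_sqr] and using s_i >= n^(-1/q) turns this into energy. *)
Lemma congested_energy w s y : 2 < q -> (0 < n)%N -> (forall i, 0 <= w i) ->
  (forall i, n%:R `^ (- q^-1) <= s i) -> energy (weight q w s) y <= 10 ->
  width < \sum_i `|y i| `^ q ->
  rounds^-1 <= \sum_(i | congestion * s i <= `|y i|) s i `^ (q - 2) * y i ^+ 2.
Proof.
move=> q2 n0.
have q0 : 0 < q by lra.
have q20 : 0 <= 2 / q by rewrite divr_ge0//; lra.
have qq : q / 2 * (2 / q) = 1 by field; lra.
have q_sub2 : 0 <= q - 2 by lra.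
have q_sub1 : 0 <= q - 1 by lra.
(* This identity of exponents is what determines [rounds]. *)
have expE : (q - 2) / (3 * q - 2) * - 1 =
    - q^-1 * (q - 2) + (q - 2) / (3 * q - 2) * ((q - 1) * (2 / q)).
  by field; apply/andP; split; lra.
have arith (b t c X Y : R) : 15 ^+ 2 <= b -> 1 <= t -> t * b < X + Y ->
    Y <= c * 10 -> 20 * c <= b -> t <= X.
  move=> b2 t1 h1 h2 h3; have : b <= t * b by rewrite ler_peMl//; lra.
  have : t <= t * b / 225 by rewrite ler_pdivlMr// ler_wpM2l; lra.
  lra.
move=> w0 sn E10 wy; have T1 := rounds_ge1 q2 n0.
have nR : 0 < n%:R :> R by rewrite ltr0n.
have s0 i : 0 < s i by apply: lt_le_trans (sn i); rewrite powR_gt0.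
have c0 : 0 <= congestion by rewrite powR_ge0.
set S := fun i => congestion * s i <= `|y i|.
have split_sum : \sum_i `|y i| `^ q =
    \sum_(i | S i) `|y i| `^ q + \sum_(i | ~~ S i) `|y i| `^ q.
  exact: bigID.
have uncong : \sum_(i | ~~ S i) `|y i| `^ q <= congestion `^ (q - 2) * 10.
  apply: (@le_trans _ _ (congestion `^ (q - 2) * energy (weight q w s) y)); last first.
    by rewrite ler_wpM2l ?powR_ge0.
  rewrite mulr_sumr big_mkcond /=; apply: ler_sum => i _.
  have u0 := @weight_gt0 R n q w s w0 s0 i.
  case: ifP => [|_]; last by rewrite mulr_ge0 ?powR_ge0// mulr_ge0 ?sqr_ge0// ltW.
  rewrite /S -ltNge => ys; rewrite -powR_sub2_sqr; last exact: ltW.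
  rewrite mulrA ler_wpM2r ?sqr_ge0//.
  apply: (@le_trans _ _ (congestion `^ (q - 2) * s i `^ (q - 2))).
    rewrite -powRM ?(ltW (s0 i))//; by apply: powR_lerl => //; exact: ltW.
  by rewrite ler_wpM2l ?powR_ge0// /weight lerDr.
have T1q : 1 <= rounds `^ (q - 1).
  by rewrite -[leLHS](powRr0 rounds) ler_powR.
have cong : rounds `^ (q - 1) <= \sum_(i | S i) `|y i| `^ q.
  apply: arith T1q _ uncong (congestion_powR q2); last by rewrite -split_sum.
  by rewrite -powR_sqr// ler_powR ?(ltW q2)// ler1n.
have sq : (rounds `^ (q - 1)) `^ (2 / q) <= \sum_(i | S i) y i ^+ 2.
  have Y0 : 0 <= \sum_(i | S i) y i ^+ 2 by apply: sumr_ge0 => i _; exact: sqr_ge0.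
  apply: (@le_trans _ _ ((\sum_(i | S i) y i ^+ 2) `^ (q / 2) `^ (2 / q))).
    apply: powR_lerl; rewrite ?powR_ge0//.
    apply: le_trans cong _; apply: sum_powR_le_sqr; exact: ltW.
  by rewrite -powRrM qq powRr1.
apply: (@le_trans _ _ (n%:R `^ (- q^-1) `^ (q - 2) * \sum_(i | S i) y i ^+ 2)); last first.
  rewrite mulr_sumr; apply: ler_sum => i _; rewrite ler_wpM2r ?sqr_ge0//.
  by apply: powR_lerl; rewrite ?powR_ge0.
apply: (le_trans _ (ler_wpM2l (powR_ge0 _ _) sq)).
rewrite /rounds -powR_inv1 ?powR_ge0// -!powRrM -powRD; last first.
  by rewrite (gt_eqF nR) implybT.
by rewrite expE.
Qed.

(** Here g is the guaranteed energy gain of this particular boost rather than [min_gain]: the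
    potential may grow by far more than [min_gain], but then g is correspondingly large. *)
Lemma width_step w s y : 2 < q -> (0 < n)%N -> (forall i, 0 <= w i) ->
  (forall i, n%:R `^ (- q^-1) <= s i) -> energy (weight q w s) y <= 10 ->
  width < \sum_i `|y i| `^ q ->
  exists g : R, [/\ min_gain <= g,
    potential q (boost q congestion s y) <= potential q s + g / 5 &
    forall z, \sum_i weight q w s i * y i * z i = energy (weight q w s) y ->
      energy (weight q w s) y + g <= energy (weight q w (boost q congestion s y)) z].
Proof.
move=> q2 n0.
set c := (q - 2) / (2 * (q + 1)).
have c0 : 0 <= c by rewrite divr_ge0//; lra.
have cE (a b : R) : 3 * (a * b) = c / 5 * (a * (30 * (q + 1) / (q - 2) * b)).
  by rewrite /c; field; apply/andP; split; lra.
move=> w0 sn E10 wy; have T1 := rounds_ge1 q2 n0.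
have nR : 0 < n%:R :> R by rewrite ltr0n.
have s0 i : 0 < s i by apply: lt_le_trans (sn i); rewrite powR_gt0.
exists (c *
  \sum_(i | congestion * s i <= `|y i|) s i `^ (q - 2) * y i ^+ 2); split.
- by rewrite /min_gain ler_wpM2l// (congested_energy q2 n0 w0).
- apply: (le_trans (boost_potential _ _ q2 s0)); rewrite lerD2l.
  rewrite mulrAC !mulr_sumr.
  apply: ler_sum => i cs.
  have -> : 3 * s i `^ q = c / 5 * (s i `^ (q - 2) * (congestion * s i) ^+ 2).
    rewrite exprMn congestion_sqr// (powR_split2 (s i) (ltW q2)) powR_sqr ?(ltW (s0 i))//.
  apply: ler_wpM2l; first by rewrite divr_ge0.
  apply: ler_wpM2l; first exact: powR_ge0.
  rewrite -[X in _ <= X]normr_sqr lerXn2r ?nnegrE//.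
  by rewrite mulr_ge0 ?powR_ge0// ltW.
move=> z /(@energy_increase R n _ (weight q w (boost q congestion s y))) h.
apply: le_trans (h _); last first.
  apply: weight_gt0 => // i; apply: lt_le_trans (s0 i) _; exact: boost_ge.
rewrite lerD2l mulr_sumr big_mkcond /=; apply: ler_sum => i _.
exact: (boost_weight_gain congestion y i q2 w0 s0).
Qed.

End WidthReduction.

(** * Existence of an optimum, linear algebra *)

Section OptimumExists.
Variable R : realType.
Local Open Scope classical_set_scope.

Lemma powR_norm_lipschitz_at (p x : R) : 2 <= p ->
  exists2 C : R, 0 < C & forall h, `|h| <= 1 ->
    `| `|x| `^ p - `|x + h| `^ p| <= C * `|h|.
Proof.
move=> p2; set w := `|x| `^ (p - 2); have w0 : 0 <= w by exact: powR_ge0.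
have B0 := powR_ge0 (2 * p + 1) p.
exists (1 + p * w * `|x| + 2 * p ^+ 2 * w + (2 * p + 1) `^ p).
  have := mulr_ge0 (mulr_ge0 (ltac:(lra) : 0 <= p) w0) (normr_ge0 x).
  have := mulr_ge0 (sqr_ge0 p) w0; lra.
move=> h h1; have lo := powR_norm_lower x h p2; have up := powR_norm_upper x h p2.
rewrite -/w in lo up.
have q0 := mulr_ge0 w0 (sqr_ge0 h).
have t0 := powR_ge0 (`|h| / 4) p.
have lin : `|p * (w * x) * h| = p * w * `|x| * `|h|.
  rewrite !normrM (ger0_norm w0) ger0_norm; [ring|lra].
have hp : ((2 * p + 1) * `|h|) `^ p <= (2 * p + 1) `^ p * `|h|.
  rewrite powRM//; last lra.
  rewrite ler_wpM2l//; have [->|h0] := eqVneq h 0.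
    by rewrite normr0 powR0//; lra.
  by apply: ge1r_powR; [rewrite normr_gt0 h0|lra].
have h2 : h ^+ 2 <= `|h|.
  by rewrite -normr_sqr expr2 ler_piMl.
have [l1 l2] : - (p * w * `|x| * `|h|) <= p * (w * x) * h /\
   p * (w * x) * h <= p * w * `|x| * `|h|.
  by apply/andP; rewrite -ler_norml lin.
rewrite ler_norml; apply/andP; split; last first.
  have := mulr_ge0 (ltac:(lra) : 0 <= p) q0.
  have := mulr_ge0 (sqr_ge0 p) w0.
  have := normr_ge0 h; nra.
have : 2 * p ^+ 2 * (w * h ^+ 2) <= 2 * p ^+ 2 * w * `|h|.
  rewrite -[leRHS]mulrA; apply: ler_wpM2l; last exact: ler_wpM2l.
  by have := sqr_ge0 p; lra.
have := normr_ge0 h; lra.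
Qed.

Lemma continuous_powR_norm (p : R) : 2 <= p -> continuous (fun t : R => `|t| `^ p).
Proof.
move=> p2 x; have [C C0 hC] := powR_norm_lipschitz_at x p2.
apply/cvgrPdist_le => /= e e0; near=> t.
have h : `|t - x| <= Num.min 1 (e / C).
  near: t; apply: (@cvgr_distC_le R R^o _ _ _ id x) => //.
  by rewrite lt_min ltr01 divr_gt0.
have := hC (t - x); have -> : x + (t - x) = t by rewrite addrC subrK.
have h1 : `|t - x| <= 1 by apply: le_trans h _; rewrite ge_min lexx.
move=> /(_ h1)/le_trans; apply.
by rewrite mulrC -ler_pdivlMr// (le_trans h)// ge_min lexx orbT.
Unshelve. all: by end_near. Qed.

Lemma continuous_sum (T : topologicalType) (I : Type) (r : seq I) (g : I -> T -> R) :
  (forall i, continuous (g i)) -> continuous (fun v => \sum_(i <- r) g i v).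
Proof.
move=> gc; elim: r => [|i r ih] x.
  under eq_fun do rewrite big_nil; exact: cvg_cst.
under eq_fun do rewrite big_cons.
by apply: cvgD; [exact: gc|exact: ih].
Qed.

Lemma lp_optimal_exists (p : R) d n (A : 'M[R]_(d, n)) (b : 'cV[R]_d) :
  2 <= p -> in_col_span A b -> exists xs, lp_optimal p A b xs.
Proof.
move=> p2 [x1 Ax1]; have p0 : 0 < p by lra.
pose f (v : 'rV[R]_n) := \sum_i `|v 0 i| `^ p.
have fc : continuous f.
  apply: continuous_sum => i v.
  apply: (@continuous_comp _ _ _ (fun v : 'rV[R]_n => v 0 i) (fun t : R => `|t| `^ p)).
    exact: coord_continuous.
  exact: continuous_powR_norm.
(* An entry is at most the p-norm, so feasible points no worse than [x1] lie in a compact box. *)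
pose M := (f x1^T) `^ p^-1.
pose box : set 'rV[R]_n := [set v | forall i, `[- M, M] (v ord0 i)].
have boxc : compact box.
  by apply: (@rV_compact _ _ (fun=> `[- M, M])) => _; exact: segment_compact.
pose F : set 'rV[R]_n := [set v | A *m v^T = b].
have Fc : closed F.
  have -> : F = \bigcap_(i in [set: 'I_d])
      (fun v : 'rV[R]_n => \sum_j A i j * v 0 j) @^-1` [set b i 0].
    apply/seteqP; split => [v vF i _ /=|v h].
      by rewrite -vF mxE; apply: eq_bigr => j _; rewrite mxE.
    apply/matrixP => i j; rewrite (ord1 j) -(h i I) mxE.
    by apply: eq_bigr => k _; rewrite mxE.
  apply: closed_bigI => i _; apply: preimage_closed; last exact: closed_eq.
  move=> v _; apply: continuous_sum => j u.
  apply: (@continuous_comp _ _ _ (fun v : 'rV[R]_n => v 0 j) (fun t : R => A i j * t)).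
    exact: coord_continuous.
  exact: mulrl_continuous.
have Kc : compact (box `&` F).
  exact: compact_closedI.
have inbox v : f v <= f x1^T -> box v.
  move=> fv i; rewrite /= in_itv/= -ler_norml.
  apply: le_trans (norm_le_root_sum_powR (fun i => v 0 i) i p0) _.
  apply: powR_lerl => //; first by rewrite invr_ge0 ltW.
  by apply: sumr_ge0 => j _; exact: powR_ge0.
have K0 : (box `&` F) !=set0.
  by exists x1^T; split; [exact: inbox|rewrite /F/= trmxK].
have [v vK vmin] := EVT_min_rV K0 Kc (continuous_subspaceT fc).
move: vK; rewrite inE => -[_ vF].
exists v^T; split => // x Ax.
have fE (u : 'cV[R]_n) : lp_norm p u = (f u^T) `^ p^-1.
  by congr (_ `^ _); apply: eq_bigr => i _; rewrite mxE.
rewrite !fE trmxK; apply: powR_lerl; first by rewrite invr_ge0 ltW.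
  by apply: sumr_ge0 => j _; exact: powR_ge0.
have [xle|xgt] := leP (f x^T) (f x1^T).
  by apply: vmin; rewrite inE; split; [exact: inbox|rewrite /F/= trmxK].
apply: le_trans (ltW xgt); apply: vmin; rewrite inE; split; first exact: inbox.
by rewrite /F/= trmxK.
Qed.

End OptimumExists.

(** * Consistency of the linear systems and first-order optimality *)

Section LinearAlgebra.
Variable R : realType.

Lemma row_sqr_eq0 k (v : 'rV[R]_k) : v *m v^T = 0 -> v = 0.
Proof.
move=> /matrixP/(_ 0 0); rewrite !mxE => h.
have {}h : \sum_j v 0 j ^+ 2 = 0.
  by rewrite -[RHS]h; apply: eq_bigr => j _; rewrite mxE expr2.
apply/matrixP => i j; rewrite (ord1 i) mxE; apply/eqP.
have v0 l : true -> 0 <= v 0 l ^+ 2 by move=> _; exact: sqr_ge0.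
by have /eqP := psumr_eq0P v0 h isT (i := j); rewrite sqrf_eq0.
Qed.

(** B and B B^T have equal rank: a vector u in the row space of B with u B^T = 0 satisfies u u^T =
    0. Hence their column spaces agree. *)
Lemma gram_solvable m k (B : 'M[R]_(m, k)) (v : 'cV[R]_k) :
  exists phi, B *m B^T *m phi = B *m v.
Proof.
have rk : \rank (B *m B^T) = \rank B.
  rewrite -(mxrank_mul_ker B B^T); apply/esym/eqP.
  rewrite -[X in _ == X]addn0 eqn_add2l mxrank_eq0 -submx0.
  apply/rV_subP => u; rewrite sub_capmx => /andP[/submxP[c uE] /sub_kermxP uB].
  rewrite (_ : u = 0) ?sub0mx//; apply: row_sqr_eq0.
  by rewrite {2}uE trmx_mul mulmxA uB mul0mx.
have sub : (B^T <= B *m B^T)%MS.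
  have [_] := mxrank_leqif_sup (submxMl B B^T).
  by rewrite rk mxrank_tr eqxx => /esym.
have /submxP[c cE] : (v^T *m B^T <= B *m B^T)%MS by exact: submx_trans (submxMl _ _) sub.
exists c^T; apply: trmx_inj.
by rewrite !trmx_mul trmxK trmxK cE mulmxA.
Qed.

Lemma weighted_gram_solvable m k (B : 'M[R]_(m, k)) (w v : 'cV[R]_k) :
  (forall i, 0 < w i 0) ->
  exists phi, B *m diag_mx w^T *m B^T *m phi = B *m v.
Proof.
move=> w0; pose r : 'rV[R]_k := \row_i Num.sqrt (w i 0).
pose v' : 'cV[R]_k := \col_i (v i 0 / Num.sqrt (w i 0)).
have [phi] := gram_solvable (B *m diag_mx r) v'.
rewrite trmx_mul tr_diag_mx mulmxA => h; exists phi.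
have -> : diag_mx w^T = diag_mx r *m diag_mx r.
  apply/matrixP => i j; rewrite mul_diag_mx !mxE.
  have [->|] := eqVneq i j; last by rewrite !mulr0n mulr0.
  by rewrite !mulr1n -expr2 sqr_sqrtr// ltW.
rewrite mulmxA h -mulmxA; congr (_ *m _); apply/matrixP => i j.
rewrite mul_diag_mx !mxE (ord1 j) mulrC divfK// gt_eqF// sqrtr_gt0.
exact: w0.
Qed.

Definition dot n (r y : 'cV[R]_n) : R := \sum_i r i 0 * y i 0.

Lemma dotE n (r y : 'cV[R]_n) : r^T *m y = (dot r y)%:M.
Proof.
apply/matrixP => i j; rewrite !mxE (ord1 i) (ord1 j) mulr1n.
by apply: eq_bigr => k _; rewrite mxE.
Qed.

Lemma scalar_mx1_inj (a b : R) : a%:M = b%:M :> 'M_1 -> a = b.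
Proof. by move=> /matrixP/(_ 0 0); rewrite !mxE !mulr1n. Qed.

Lemma dot_mulmxT d n (A : 'M[R]_(d, n)) u (z : 'cV[R]_n) :
  dot (A^T *m u) z = dot u (A *m z).
Proof.
apply: scalar_mx1_inj; rewrite -!dotE.
by rewrite trmx_mul trmxK mulmxA.
Qed.

Lemma dotDl n (x y z : 'cV[R]_n) : dot (x + y) z = dot x z + dot y z.
Proof. by rewrite -big_split; apply: eq_bigr => i _; rewrite mxE mulrDl. Qed.

Lemma dotZl n c (x z : 'cV[R]_n) : dot (c *: x) z = c * dot x z.
Proof. by rewrite mulr_sumr; apply: eq_bigr => i _; rewrite mxE mulrA. Qed.

Lemma dotDr n (x y z : 'cV[R]_n) : dot z (x + y) = dot z x + dot z y.
Proof. by rewrite -big_split; apply: eq_bigr => i _; rewrite mxE mulrDr. Qed.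

Lemma dotZr n c (x z : 'cV[R]_n) : dot z (c *: x) = c * dot z x.
Proof. by rewrite mulr_sumr; apply: eq_bigr => i _; rewrite mxE mulrCA. Qed.

Lemma dot0r n (z : 'cV[R]_n) : dot z 0 = 0.
Proof. by rewrite /dot big1// => i _; rewrite mxE mulr0. Qed.

Definition direction d n (A : 'M[R]_(d, n)) (r y : 'cV[R]_n) : Prop :=
  A *m y = 0 /\ dot r y = 1.

(* The stationarity condition u y \in rowspace (A, r) makes y minimize the energy
   over all directions. *)
Lemma direction_stationary d n (A : 'M[R]_(d, n)) (r y z : 'cV[R]_n)
    (u : 'I_n -> R) v t :
  (forall i, u i * y i 0 = (A^T *m v + t *: r) i 0) ->
  direction A r y -> direction A r z ->
  \sum_i u i * y i 0 * z i 0 = energy u (fun i => y i 0).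
Proof.
move=> uy [Ay ry] [Az rz].
transitivity (dot (A^T *m v + t *: r) z).
  by apply: eq_bigr => i _; rewrite uy.
transitivity (dot (A^T *m v + t *: r) y).
  by rewrite !dotDl !dotZl !dot_mulmxT Ay Az ry rz.
by apply: eq_bigr => i _; rewrite -uy expr2 mulrA.
Qed.

(** Here w holds the inverses of the energy weights. The witness z makes the system consistent, so
    the solver's guarantee applies; without a direction nothing is known about phi, which is why the
    program tests [violation]. *)
Lemma solve_call_direction d n (A : 'M[R]_(d, n)) (r w z : 'cV[R]_n)
    (solve : forall m, 'M[R]_m -> 'cV[R]_m -> 'cV[R]_m) :
  linear_solver solve -> (forall i, 0 < w i 0) -> direction A r z ->
  let phi := solve_call A solve r w 1 in
  direction A r (\col_i (w i 0 * (A^T *m usubmx phi + dsubmx phi 0 0 *: r) i 0)).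
Proof.
move=> ls w0 [Az rz] phi; set y := \col_i _.
have [psi hpsi] := weighted_gram_solvable (append_row A r) z w0.
have rhs : append_row A r *m z = col_mx 0 1%:M.
  by rewrite /append_row mul_col_mx Az dotE rz.
have : append_row A r *m diag_mx w^T *m (append_row A r)^T *m phi = col_mx 0 1%:M.
  by apply: ls; exists psi; rewrite hpsi.
have -> : append_row A r *m diag_mx w^T *m (append_row A r)^T *m phi =
          append_row A r *m y.
  rewrite -!mulmxA; congr (_ *m _).
  rewrite /append_row tr_col_mx trmxK -[in LHS](vsubmxK phi) mul_row_col.
  apply/matrixP => i j; rewrite mul_diag_mx (ord1 j) !mxE.
  congr (_ * (_ + _)); rewrite big_ord1 mulrC; congr (_ * _).
  by rewrite !mxE; congr (phi _ _); apply/val_inj => //=.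
rewrite /append_row mul_col_mx => /eq_col_mx[Ay ry]; split => //.
by move: ry; rewrite dotE => /scalar_mx1_inj.
Qed.

Lemma least_squares_min d n (A : 'M[R]_(d, n)) (b : 'cV[R]_d)
    (solve : forall m, 'M[R]_m -> 'cV[R]_m -> 'cV[R]_m) :
  linear_solver solve -> in_col_span A b ->
  let x0 := A^T *m solve _ (A *m A^T) b in
  A *m x0 = b /\ forall x, A *m x = b -> \sum_i x0 i 0 ^+ 2 <= \sum_i x i 0 ^+ 2.
Proof.
move=> ls [x1 Ax1] x0.
have Ax0 : A *m x0 = b.
  rewrite mulmxA ls//; have [phi h] := gram_solvable A x1.
  by exists phi; rewrite h.
split => // x Ax.
have E (u : 'cV[R]_n) : \sum_i u i 0 ^+ 2 = energy (fun=> 1) (fun i => u i 0).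
  by apply: eq_bigr => i _; rewrite mul1r.
rewrite !E; apply: energy_min => //.
transitivity (dot x0 x); first by apply: eq_bigr => i _; rewrite mul1r.
transitivity (dot x0 x0); first by rewrite {1 3}/x0 !dot_mulmxT Ax Ax0.
by apply: eq_bigr => i _; rewrite mul1r expr2.
Qed.

End LinearAlgebra.

(** * The residual problem *)

Section InnerExponent.
Variables (R : realType) (p : R) (n : nat).

Definition log_cap : R := 1 + ln n%:R.
Definition inner_exp : R := Num.min (Num.max p (2 + log_cap^-1)) (2 + log_cap).
Local Notation L := log_cap.
Local Notation q := inner_exp.

Lemma log_cap_ge1 : (0 < n)%N -> 1 <= L.
Proof. by move=> n0; rewrite lerDl ln_ge0// ler1n. Qed.

Lemma inner_exp_cases : 2 <= p -> (0 < n)%N ->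
  [/\ 2 + L^-1 <= q, q <= 2 + L, q <= p + 1 &
   [\/ q = p, (q < p /\ q = 2 + L) | (p < q /\ q = 2 + L^-1)]].
Proof.
move=> p2 /log_cap_ge1; rewrite /inner_exp; set l := log_cap => l1.
have lV : l^-1 <= 1 by rewrite invf_le1//; lra.
have lV0 : 0 < l^-1 by rewrite invr_gt0; lra.
case: (leP p (2 + l^-1)) => h1.
  rewrite min_l; last lra.
  split; try lra.
  have [->|ne] := eqVneq p (2 + l^-1); first by constructor 1.
  by constructor 3; split => //; rewrite lt_neqAle ne.
case: (leP p (2 + l)) => h2; first by split; try lra; constructor 1.
by split; try lra; constructor 2; split; lra.
Qed.

Lemma inner_exp_gt2 : 2 <= p -> (0 < n)%N -> 2 < q.
Proof.
move=> p2 n0; have [h _ _ _] := inner_exp_cases p2 n0.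
apply: lt_le_trans h; rewrite ltrDl invr_gt0.
by have := log_cap_ge1 n0; lra.
Qed.

Lemma natr_expR_ln : (0 < n)%N -> n%:R = expR (ln n%:R) :> R.
Proof. by move=> n0; rewrite lnK// posrE ltr0n. Qed.

Lemma expR_le_powR4 (z : R) : 0 <= z -> expR z <= 4 `^ z.
Proof.
move=> z0; rewrite -[X in expR X](mul1r z) expRM.
by apply: powR_lerl => //; [exact: expR_ge0|exact: expR1_le4].
Qed.

Lemma natr_powR_log_cap : (0 < n)%N -> n%:R `^ L^-1 <= 4 :> R.
Proof.
move=> n0; have l1 := log_cap_ge1 n0; have nR : 0 < n%:R :> R by rewrite ltr0n.
rewrite /powR gt_eqF//; apply: le_trans (@expR1_le4 R); rewrite ler_expR.
by rewrite mulrC ler_pdivrMr ?mul1r /log_cap; move: l1; rewrite /log_cap; lra.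
Qed.

(** All entries of 4 y are at most 1, which settles p <= q. If q < p then q = 2 + L, and the n
    terms, each at most 1, sum to n <= 4^q: the slack 4 absorbs the change of exponent. *)
Lemma sum_powR_to_inner (y : 'I_n -> R) : 2 <= p -> (0 < n)%N ->
  \sum_i `|4 * y i| `^ p <= 1 -> \sum_i `|y i| `^ q <= 1.
Proof.
move=> p2 n0 h; have [_ _ _ qc] := inner_exp_cases p2 n0.
have q2 := inner_exp_gt2 p2 n0.
have p0 : 0 < p by lra.
have q0 : 0 <= q by lra.
have y1 i : `|4 * y i| <= 1 := norm_le1_sum_powR i p0 h.
suff : \sum_i `|4 * y i| `^ q <= 4 `^ q.
  rewrite sum_powR_scale// -[leRHS]mulr1 ler_pM2l// powR_gt0//.
have g4 : 1 <= (4 : R) `^ q.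
  by rewrite -[leLHS](powRr0 4) ler_powR// ler1n.
have mono i : p <= q -> `|4 * y i| `^ q <= `|4 * y i| `^ p.
  move=> pq; have [y0|y0] := eqVneq (4 * y i) 0.
    by rewrite y0 normr0 !powR0// gt_eqF//; lra.
  by apply: ger_powR => //; rewrite normr_gt0 y0 y1.
have [pq|] := leP p q.
  by apply: le_trans g4; apply: le_trans h; apply: ler_sum => i _; exact: mono.
case: qc => [->|[_ qE]|[pq _]] qp; rewrite ?ltxx// in qp; last first.
  by move: (lt_trans pq qp); rewrite ltxx.
apply: (@le_trans _ _ (\sum_(i < n) 1)).
  apply: ler_sum => i _; have := powR_lerl q0 (normr_ge0 _) (y1 i).
  by rewrite powR1.
rewrite sumr_const card_ord natr_expR_ln//.
apply: le_trans (expR_le_powR4 q0); rewrite ler_expR qE /log_cap; lra.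
Qed.

Lemma sum_powR_from_inner (v : 'I_n -> R) : 2 <= p -> (0 < n)%N ->
  \sum_i `|v i| `^ q <= 7 -> \sum_i `|v i| `^ p <= 35 `^ p.
Proof.
move=> p2 n0 h; have [_ _ _ qc] := inner_exp_cases p2 n0.
have q2 := inner_exp_gt2 p2 n0.
have p0 : 0 < p by lra.
have q0 : 0 < q by lra.
have q1 : 1 <= q by lra.
have p1 : 1 <= p by lra.
pose u i := 7^-1 * v i.
have u1 : \sum_i `|u i| `^ q <= 1.
  rewrite sum_powR_scale ?invr_ge0//.
  have : (7^-1 : R) `^ q <= 7^-1 by apply: ge1r_powR => //; rewrite invr_gt0 ltr0n /= invf_le1 ?ler1n.
  move=> h7; rewrite -[leRHS](@mulVf _ (7 : R)) ?pnatr_eq0//.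
  by apply: ler_pM => //; [exact: powR_ge0|apply: sumr_ge0 => i _; exact: powR_ge0].
have ui i : `|u i| <= 1 := norm_le1_sum_powR i q0 u1.
suff {h} up : \sum_i `|u i| `^ p <= 5 `^ p.
  have -> : \sum_i `|v i| `^ p = \sum_i `|7 * u i| `^ p.
    by apply: eq_bigr => i _; rewrite /u mulrA mulfV ?pnatr_eq0// mul1r.
  rewrite sum_powR_scale//; have -> : (35 : R) = 7 * 5 by rewrite -natrM.
  by rewrite [leRHS]powRM// ler_wpM2l ?powR_ge0.
have g5 : (5 : R) <= 5 `^ p by apply: le1r_powR => //; rewrite ler1n.
have [qp|] := leP q p.
  apply: (@le_trans _ _ 1); last by apply: le_trans g5; rewrite ler1n.
  apply: le_trans u1; apply: ler_sum => i _; have [y0|y0] := eqVneq (u i) 0.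
    by rewrite y0 normr0 !powR0// gt_eqF.
  by apply: ger_powR => //; rewrite normr_gt0 y0 ui.
case: qc => [->|[qp _]|[_ qE]] pq; rewrite ?ltxx// in pq.
  by move: (lt_trans pq qp); rewrite ltxx.
have nR : 0 < n%:R :> R by rewrite ltr0n.
have npow : n%:R `^ (q - p) <= 4 :> R.
  apply: (@le_trans _ _ (n%:R `^ L^-1)).
    by rewrite ler_powR ?ler1n// qE; lra.
  exact: natr_powR_log_cap.
(* Here p < q = 2 + 1/L. Entries above 1/n lose a factor at most n^(q-p) <= 4, the others sum to at
   most 1. This gives 5 = 4 + 1, and 35 = 7 * 5 after undoing the scaling. *)
have term i : `|u i| `^ p <= 4 * `|u i| `^ q + n%:R^-1.
  have [small|big] := leP `|u i| n%:R^-1.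
    apply: (@le_trans _ _ n%:R^-1); last by rewrite lerDr mulr_ge0// powR_ge0.
    apply: le_trans small; have [y0|y0] := eqVneq (u i) 0.
      by rewrite y0 normr0 !powR0// gt_eqF.
    by apply: ge1r_powR => //; rewrite normr_gt0 y0 ui.
  have un0 : 0 < `|u i| by apply: lt_trans big; rewrite invr_gt0.
  apply: (@le_trans _ _ (4 * `|u i| `^ q)); last by rewrite lerDl invr_ge0 ltW.
  have -> : `|u i| `^ p = (`|u i|^-1) `^ (q - p) * `|u i| `^ q.
    rewrite -powR_inv1 ?normr_ge0// -powRrM -powRD ?(gt_eqF un0) ?implybT//.
    by congr (_ `^ _); ring.
  rewrite ler_wpM2r ?powR_ge0//; apply: le_trans npow.
  apply: powR_lerl; rewrite ?invr_ge0 ?normr_ge0//; first by rewrite subr_ge0 ltW.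
  by rewrite -[leRHS]invrK lef_pV2 ?posrE ?invr_gt0// ltW.
apply: (le_trans (ler_sum _ (fun i _ => term i))).
rewrite big_split/= -mulr_sumr sumr_const card_ord -[_ *+ n]mulr_natl mulfV ?gt_eqF//.
apply: le_trans g5; have -> : (5 : R) = 4 * 1 + 1 by lra.
by rewrite lerD2r ler_pM2l.
Qed.

End InnerExponent.

(** * The normalized residual problem and the progress made by its solutions *)

Section Residual.
Variables (R : realType) (d n : nat) (A : 'M[R]_(d, n)) (p : R).
Implicit Types (x y X D : 'cV[R]_n) (nu : R).
Local Notation q := (inner_exp p n).

Definition psum x : R := \sum_i `|x i 0| `^ p.
Definition pweight x i : R := `|x i 0| `^ (p - 2).
Definition pgrad x : 'cV[R]_n := \col_i (p * (pweight x i * x i 0)).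
(** The length scale that normalizes the bounds on the direction to 1. In 16 = 4 * 4, one 4 comes
    from |D|/4 in [psum_lower], the other from [sum_powR_to_inner]. *)
Definition sigma nu : R := 16 * (nu / 2) `^ p^-1.
Definition res_row nu x : 'cV[R]_n := (- (2 * sigma nu / nu)) *: pgrad x.
Definition res_weight nu x i : R := sigma nu ^+ 2 * p / (2 * nu) * pweight x i.

Lemma psum_ge0 x : 0 <= psum x.
Proof. by apply: sumr_ge0 => i _; exact: powR_ge0. Qed.

Lemma energyZ (u : 'I_n -> R) c y :
  energy u (fun i => (c *: y) i 0) = c ^+ 2 * energy u (fun i => y i 0).
Proof. by rewrite mulr_sumr; apply: eq_bigr => i _; rewrite mxE exprMn mulrCA. Qed.

Lemma energyZl (u : 'I_n -> R) c (y : 'I_n -> R) :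
  energy (fun i => c * u i) y = c * energy u y.
Proof. by rewrite mulr_sumr; apply: eq_bigr => i _; rewrite mulrA. Qed.

Lemma energy_ge0 (u y : 'I_n -> R) : (forall i, 0 <= u i) -> 0 <= energy u y.
Proof. by move=> u0; apply: sumr_ge0 => i _; rewrite mulr_ge0 ?sqr_ge0. Qed.

Lemma psum_lower x D : 2 <= p ->
  psum x + dot (pgrad x) D + p / 4 * energy (pweight x) (fun i => D i 0)
    + \sum_i (`|D i 0| / 4) `^ p <= psum (x + D).
Proof.
move=> p2; rewrite /psum /dot /energy mulr_sumr -!big_split/=; apply: ler_sum => i _.
by rewrite !mxE; exact: powR_norm_lower.
Qed.

Lemma psum_upper x D : 2 <= p ->
  psum (x + D) <= psum x + dot (pgrad x) D
    + 2 * p ^+ 2 * energy (pweight x) (fun i => D i 0)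
    + (2 * p + 1) `^ p * psum D.
Proof.
move=> p2; have p1 : 0 <= 2 * p + 1 by lra.
rewrite /psum /dot /energy !mulr_sumr -!big_split/=; apply: ler_sum => i _.
rewrite !mxE -powRM//; exact: powR_norm_upper.
Qed.

Lemma sigma_gt0 nu : 0 < nu -> 0 < sigma nu.
Proof. by move=> nu0; rewrite mulr_gt0// powR_gt0// divr_gt0. Qed.

Lemma sigma_powR nu : 2 <= p -> 0 < nu -> sigma nu `^ p = 16 `^ p * (nu / 2).
Proof.
move=> p2 nu0; rewrite powRM ?powR_ge0// powR_inv_root//; first lra.
by rewrite divr_ge0// ltW.
Qed.

Lemma res_weight_ge0 nu x i : 2 <= p -> 0 < nu -> 0 <= res_weight nu x i.
Proof.
move=> p2 nu0; rewrite mulr_ge0 ?powR_ge0// divr_ge0//; last lra.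
by rewrite mulr_ge0 ?sqr_ge0//; lra.
Qed.

Lemma residual_feasible nu x xs : 2 <= p -> (0 < n)%N -> 0 < nu ->
  A *m x = A *m xs -> nu / 2 < psum x - psum xs ->
  exists y, [/\ direction A (res_row nu x) y,
    energy (res_weight nu x) (fun i => y i 0) <= 1 &
    \sum_i `|y i 0| `^ q <= 1].
Proof.
move=> p2 n0 nu0 Ax gap; have s0 := sigma_gt0 nu0.
pose D : 'cV[R]_n := xs - x; pose G := - dot (pgrad x) D.
pose W := energy (pweight x) (fun i => D i 0).
pose P := \sum_i (`|D i 0| / 4) `^ p.
have W0 : 0 <= W by apply: energy_ge0 => i; exact: powR_ge0.
have P0 : 0 <= P by apply: sumr_ge0 => i _; exact: powR_ge0.
have AD : A *m D = 0 by rewrite mulmxBr Ax subrr.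
have := psum_lower x D p2; have -> : x + D = xs by rewrite /D addrC subrK.
rewrite -/W -/P.
rewrite -[dot _ D]opprK -/G => low'.
have arith (a b : R) : nu / 2 < a - b -> a - G + p / 4 * W + P <= b ->
    [/\ nu / 2 < G, p / 4 * W <= G & P <= G].
  move=> h1 h2; have : 0 <= p * W by rewrite mulr_ge0//; lra.
  by split; lra.
have [Gnu WG PG] := arith _ _ gap low'.
move: arith gap low' => _ _ _.
have G0 : 0 < G by lra.
(* Shortening by th makes the linear term exactly nu/2. The quadratic and p-th power terms, both at
   most G up to their constants, shrink by th^2 and th^p, hence at least as fast as the linear
   one. *)
pose th := nu / 2 / G.
have th0 : 0 < th by rewrite !divr_gt0.
have th1 : th <= 1 by rewrite ler_pdivrMr//; lra.
have thG : th * G = nu / 2 by rewrite /th divfK// gt_eqF.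
exists ((th / sigma nu) *: D); split.
- split; first by rewrite -scalemxAr AD scaler0.
  rewrite dotZr dotZl -[dot _ D]opprK -/G.
  have -> : th / sigma nu * (- (2 * sigma nu / nu) * - G) = (th * G) * 2 / nu.
    by field; apply/andP; split; rewrite gt_eqF.
  by rewrite thG; field; rewrite gt_eqF.
- rewrite energyZ /res_weight energyZl -/W.
  have -> : (th / sigma nu) ^+ 2 * (sigma nu ^+ 2 * p / (2 * nu) * W) =
            th ^+ 2 * (2 / nu) * (p / 4 * W).
    by field; apply/andP; split; rewrite gt_eqF.
  apply: (@le_trans _ _ (th ^+ 2 * (2 / nu) * G)).
    by rewrite ler_wpM2l// mulr_ge0 ?sqr_ge0// divr_ge0// ltW.
  have -> : th ^+ 2 * (2 / nu) * G = th * (2 / nu * (th * G)) by ring.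
  have -> : 2 / nu * (th * G) = 1 by rewrite thG; field; rewrite gt_eqF.
  by rewrite mulr1.
apply: sum_powR_to_inner => //.
have -> : \sum_i `|4 * ((th / sigma nu) *: D) i 0| `^ p =
    \sum_i `|16 * (th / sigma nu) * (`|D i 0| / 4)| `^ p.
  apply: eq_bigr => i _; rewrite mxE; congr (_ `^ _).
  have c0 : 0 <= th / sigma nu by rewrite divr_ge0// ltW.
  have -> : 16 * (th / sigma nu) * (`|D i 0| / 4) = 4 * (th / sigma nu) * `|D i 0|.
    by field; rewrite gt_eqF.
  by rewrite mulrA !normrM normr_id.
have PE : \sum_i `| `|D i 0| / 4 | `^ p = P.
  by apply: eq_bigr => i _; rewrite ger0_norm// divr_ge0.
have c0 : 0 <= th / sigma nu by rewrite divr_ge0// ltW.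
have -> : \sum_i `|16 * (th / sigma nu) * (`|D i 0| / 4)| `^ p =
    (16 * (th / sigma nu)) `^ p * P.
  have c16 : 0 <= 16 * (th / sigma nu) by apply: mulr_ge0.
  by rewrite -PE -sum_powR_scale.
have -> : (16 * (th / sigma nu)) `^ p = th `^ p * (2 / nu).
  have sp := sigma_powR p2 nu0.
  have sp0 : 0 < sigma nu `^ p by rewrite powR_gt0.
  have e16 : 0 < (16 : R) `^ p by rewrite powR_gt0.
  rewrite powRM// powRM ?invr_ge0 ?(ltW th0) ?(ltW s0)//.
  rewrite -[(sigma nu)^-1]powR_inv1 ?(ltW s0)// -powRrM mulN1r powRN sp.
  by field; rewrite !gt_eqF.
apply: (@le_trans _ _ (th `^ p * (2 / nu) * G)).
  by rewrite ler_wpM2l// mulr_ge0 ?powR_ge0// divr_ge0// ltW.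
have tp : th `^ p <= th by apply: ge1r_powR; [rewrite th0 th1|lra].
apply: (@le_trans _ _ (th * (2 / nu) * G)).
  by rewrite ler_wpM2r ?(ltW G0)// ler_wpM2r// divr_ge0// ltW.
have -> : th * (2 / nu) * G = 2 / nu * (th * G) by ring.
have -> : 2 / nu * (th * G) = 1 by rewrite thG; field; rewrite gt_eqF.
by [].
Qed.

(** Moving back from a solution incurs the constants 2p + 1, 45 q and 35, whose product is at most
    10^5 p q. The remaining 10^7 makes the p-th power term negligible. *)
Definition step_scale : R := 10 ^+ 12 * p * q.

(** The ratio is 10^-7, where 10^7 = 25 * (4 * 10^5): in the (p-1)-th power, 25 pays for p q <= p (p
    + 1) and 4 * 10^5 for the remaining constant. *)
Lemma step_scale_bound : 2 <= p -> (0 < n)%N ->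
  (10 ^+ 5 * p * q / step_scale) `^ p <= (4 * step_scale)^-1.
Proof.
move=> p2 n0; have q2 := inner_exp_gt2 p2 n0.
have [_ _ qp1 _] := inner_exp_cases p2 n0.
rewrite /step_scale; set l := q in q2 qp1 *.
have -> : 10 ^+ 5 * p * l / (10 ^+ 12 * p * l) = (10 ^+ 7)^-1.
  by field; apply/andP; split; lra.
have b : (25 : R) `^ (p - 1) = (5 `^ (p - 1)) ^+ 2.
  rewrite -powR_sqr ?powR_ge0// -powRrM mulrC powRrM; congr (_ `^ _).
  by rewrite powR_sqr//; lra.
have p1 : 1 <= p - 1 by lra.
have b5 : 1 + (p - 1) * (5 - 1) <= 5 `^ (p - 1) by exact: bernoulli_powR.
have b25 : p * l <= 25 `^ (p - 1).
  rewrite b; apply: (@le_trans _ _ ((4 * p - 3) ^+ 2)); last first.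
    rewrite lerXn2r ?nnegrE ?powR_ge0//; first lra.
    apply: le_trans b5; lra.
  apply: (@le_trans _ _ (p * (p + 1))); first by rewrite ler_wpM2l//; lra.
  nra.
rewrite -powR_inv1 ?exprn_ge0// -powRrM mulN1r powRN.
rewrite lef_pV2 ?posrE ?powR_gt0 ?exprn_gt0 ?mulr_gt0//; try lra.
rewrite -(powRB_mul p (exprn_gt0 7 (ltr0n R 10))).
have c7 : (10 : R) ^+ 7 = 25 * (4 * 10 ^+ 5) by rewrite !exprS expr0; lra.
rewrite {1}c7 powRM// ?mulr_ge0 ?exprn_ge0//.
have c5 : 4 * 10 ^+ 5 <= (4 * 10 ^+ 5) `^ (p - 1) :> R.
  by apply: le1r_powR => //; rewrite !exprS expr0; lra.
have -> : 4 * (10 ^+ 12 * p * l) = p * l * (4 * 10 ^+ 5) * 10 ^+ 7.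
  by rewrite !exprS expr0; ring.
rewrite ler_wpM2r ?exprn_ge0//; apply: ler_pM => //; last by rewrite mulr_ge0 ?exprn_ge0.
by rewrite mulr_ge0//; lra.
Qed.

(** The linear term gains nu/(2 step_scale); the quadratic and the p-th power terms each cost at
    most a quarter of that. *)
Lemma residual_progress nu x X (k : R) (s : 'I_n -> R) : 2 <= p -> (0 < n)%N ->
  0 < nu -> 0 < k -> dot (res_row nu x) X = k ->
  energy (res_weight nu x) (fun i => X i 0) <= 10 * k ^+ 2 ->
  (forall i, `|X i 0| <= 45 * q * k * s i) -> \sum_i s i `^ q <= 7 ->
  psum (x + (sigma nu / (step_scale * k)) *: X) <= psum x - nu / (4 * step_scale).
Proof.
move=> p2 n0 nu0 k0 rX eX sX s7; have s0 := sigma_gt0 nu0.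
have q2 := inner_exp_gt2 p2 n0.
have p0 : 0 < p by lra.
have q0 : 0 < q by lra.
have l0 : 0 < step_scale by rewrite !mulr_gt0 ?exprn_gt0//; lra.
have si0 i : 0 <= s i.
  have := le_trans (normr_ge0 _) (sX i); rewrite pmulr_rge0//.
  by rewrite !mulr_gt0.
set c := sigma nu / (step_scale * k).
have c0 : 0 < c by rewrite divr_gt0// mulr_gt0.
have qk0 : 0 <= 45 * q * k by rewrite !mulr_ge0 ?(ltW q0) ?(ltW k0).
have ck0 : 0 <= c * (45 * q * k) by apply: mulr_ge0 => //; exact: ltW.
have lin : dot (pgrad x) (c *: X) = - (nu / (2 * step_scale)).
  have : dot (pgrad x) X = - (nu / (2 * sigma nu)) * k.
    rewrite -rX /res_row dotZl; field; rewrite !gt_eqF//.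
  rewrite dotZr => ->; rewrite /c; field; by rewrite !gt_eqF.
have quad : 2 * p ^+ 2 * energy (pweight x) (fun i => (c *: X) i 0)
    <= nu / (8 * step_scale).
  rewrite energyZ; move: eX; rewrite /res_weight energyZl.
  set W := energy _ _; rewrite -ler_pdivlMl; last first.
    apply: divr_gt0; apply: mulr_gt0 => //; exact: exprn_gt0.
  move=> hW; apply: (@le_trans _ _ (2 * p ^+ 2 * (c ^+ 2 *
       ((sigma nu ^+ 2 * p / (2 * nu))^-1 * (10 * k ^+ 2))))).
    apply: ler_wpM2l; first by rewrite mulr_ge0 ?sqr_ge0.
    by apply: ler_wpM2l => //; exact: sqr_ge0.
  have -> : 2 * p ^+ 2 * (c ^+ 2 *
       ((sigma nu ^+ 2 * p / (2 * nu))^-1 * (10 * k ^+ 2))) =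
       nu / step_scale * (40 * p / step_scale).
    rewrite /c; field; rewrite !gt_eqF//; lra.
  have -> : nu / (8 * step_scale) = nu / step_scale * 8^-1.
    by field; rewrite gt_eqF.
  rewrite ler_wpM2l ?divr_ge0 ?(ltW nu0) ?(ltW l0)// ler_pdivrMr//.
  rewrite /step_scale; have : 0 <= p * (q - 2) by rewrite mulr_ge0//; lra.
  rewrite !exprS expr0; nra.
have pow : (2 * p + 1) `^ p * psum (c *: X) <= nu / (8 * step_scale).
  have sE : \sum_i `|s i| `^ q <= 7.
    by under eq_bigr do rewrite ger0_norm ?si0//.
  have sp := sum_powR_from_inner p2 n0 sE.
  have : psum (c *: X) <= (c * (45 * q * k)) `^ p * 35 `^ p.
    apply: le_trans (ler_wpM2l (powR_ge0 _ _) sp).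
    rewrite -sum_powR_scale//.
    apply: ler_sum => i _; apply: powR_lerl => //; first lra.
    rewrite mxE normrM (ger0_norm (ltW c0)).
    rewrite (@ger0_norm _ (c * _ * s i)); last by apply: mulr_ge0.
    by rewrite -mulrA; apply: ler_wpM2l; [exact: ltW|exact: sX].
  have b0 : 0 <= 2 * p + 1 by lra.
  move=> /(ler_wpM2l (powR_ge0 (2 * p + 1) p))/le_trans; apply.
  rewrite -[X in _ * X]powRM// -powRM//; last by apply: mulr_ge0.
  have -> : (2 * p + 1) * (c * (45 * q * k) * 35) =
     sigma nu * (1575 * (2 * p + 1) * q / step_scale).
    by rewrite /c; field; rewrite !gt_eqF.
  have e0 : 0 <= 1575 * (2 * p + 1) * q / step_scale.
    by rewrite divr_ge0 ?(ltW l0)// !mulr_ge0 ?(ltW q0).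
  rewrite powRM ?(ltW s0)// sigma_powR// mulrAC -powRM//.
  have hb := step_scale_bound p2 n0.
  apply: (@le_trans _ _ ((4 * step_scale)^-1 * (nu / 2))); last first.
    by rewrite le_eqVlt; apply/orP; left; apply/eqP; field; rewrite gt_eqF.
  rewrite ler_wpM2r ?divr_ge0 ?(ltW nu0)//; apply: le_trans hb.
  apply: powR_lerl; [lra|by rewrite mulr_ge0|].
  rewrite mulrA ler_wpM2r ?invr_ge0 ?(ltW l0)// mulrA ler_wpM2r ?(ltW q0)//.
  rewrite !exprS expr0; lra.
apply: (le_trans (psum_upper _ _ p2)); rewrite lin.
have -> : psum x - nu / (4 * step_scale) = psum x - nu / (2 * step_scale)
    + nu / (8 * step_scale) + nu / (8 * step_scale).
  by field; rewrite gt_eqF.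
by apply: lerD => //; apply: lerD.
Qed.

End Residual.

(** * One iteration, its invariant and its measure *)

Record iterate (R : realType) (n : nat) := Iterate {
  it_x : 'cV[R]_n;
  it_nu : R;
  it_s : 'cV[R]_n;
  it_X : 'cV[R]_n;
  it_k : R
}.

Section Step.
Variables (R : realType) (d n : nat) (A : 'M[R]_(d, n)) (p : R).
Implicit Types (x y s X z : 'cV[R]_n) (nu k e : R).
Local Notation q := (inner_exp p n).
Local Notation T := (rounds n q).
Local Notation lam := (step_scale n p).

Definition entries (v : 'cV[R]_n) : 'I_n -> R := fun i => v i 0.
Definition start_s : 'cV[R]_n := const_mx (n%:R `^ (- q^-1)).
Definition restart x nu := Iterate x nu start_s 0 0.
Definition cur_weight (st : iterate R n) : 'I_n -> R :=
  weight q (res_weight p (it_nu st) (it_x st)) (entries (it_s st)).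
(** A sum of squares, so that one scalar comparison with 0 decides all equations defining a
    direction. *)
Definition violation (r y : 'cV[R]_n) : R :=
  \sum_j (A *m y) j 0 ^+ 2 + (dot r y - 1) ^+ 2.

Definition flow_s s y : 'cV[R]_n := \col_i (s i 0 + (45 * q * T)^-1 * `|y i 0|).
Definition boost_s s y : 'cV[R]_n := \col_i boost q (congestion q) (entries s) (entries y) i.

Definition next_iterate (st : iterate R n) (y : 'cV[R]_n) : iterate R n :=
  let: Iterate x nu s X k := st in
  if violation (res_row p nu x) y <= 0 then
    if energy (cur_weight st) (entries y) <= 10 then
      if \sum_i `|y i 0| `^ q <= width n q then
        if T <= k + 1 then
          restart (x + (sigma p nu / (lam * (k + 1))) *: (X + y)) nu
        else Iterate x nu (flow_s s y) (X + y) (k + 1)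
      else Iterate x nu (boost_s s y) X k
    else restart x (nu / 2)
  else restart x (nu / 2).

Lemma violation_direction r y : violation r y <= 0 <-> direction A r y.
Proof.
have S0 : 0 <= \sum_j (A *m y) j 0 ^+ 2 by apply: sumr_ge0 => j _; exact: sqr_ge0.
split=> [h|[Ay ry]]; last first.
  by rewrite /violation ry Ay subrr expr0n addr0 big1// => i _; rewrite mxE expr0n.
have r0 := sqr_ge0 (dot r y - 1).
have v0 : violation r y = 0 by apply/eqP; rewrite eq_le h addr_ge0.
have /andP[/eqP v1 /eqP v2] :
    (\sum_j (A *m y) j 0 ^+ 2 == 0) && ((dot r y - 1) ^+ 2 == 0).
  by rewrite -paddr_eq0//; apply/eqP.
split; last by apply/eqP; rewrite -subr_eq0 -sqrf_eq0; apply/eqP.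
apply/matrixP => i j; rewrite (ord1 j) [RHS]mxE; apply/eqP; rewrite -sqrf_eq0.
have w0 l : true -> 0 <= (A *m y) l 0 ^+ 2 by move=> _; exact: sqr_ge0.
exact/eqP/(psumr_eq0P w0 v1).
Qed.

(** [e] is a ghost quantity stored in no register. [inv_X0] covers the first round, where the
    convexity weight (k+1)/k is undefined, and [inv_X] records that s has grown along with |X|. *)
Record inner_inv x nu s X k e : Prop := InnerInv {
  inv_k0 : 0 <= k;
  inv_s : forall i, n%:R `^ (- q^-1) <= s i 0;
  inv_e0 : 0 <= e;
  inv_e : forall z, direction A (res_row p nu x) z ->
    e <= energy (weight q (res_weight p nu x) (entries s)) (entries z);
  inv_pot : potential q (entries s) <= 1 + 2 * k / T + e / 5;
  inv_A : A *m X = 0;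
  inv_row : dot (res_row p nu x) X = k;
  inv_energy : energy (res_weight p nu x) (entries X) <= 10 * k ^+ 2;
  inv_X0 : k = 0 -> X = 0;
  inv_X : forall i, `|X i 0| <= 45 * q * T * s i 0
}.

Hypotheses (p2 : 2 <= p) (n0 : (0 < n)%N).

Lemma start_inv x nu : 0 < nu -> inner_inv x nu start_s 0 0 0.
Proof.
move=> nu0; have q2 := inner_exp_gt2 p2 n0; have T1 := rounds_ge1 q2 n0.
have nR : 0 < n%:R :> R by rewrite ltr0n.
have z0 : 0 <= 45 * q * T.
  by rewrite mulr_ge0//; [rewrite mulr_ge0//; lra|lra].
split => //.
- by move=> i; rewrite mxE.
- move=> z _; apply: energy_ge0 => i; apply/ltW/weight_gt0.
    by move=> j; exact: res_weight_ge0.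
  by move=> j; rewrite /entries mxE powR_gt0.
- have qn : q != 0 by rewrite gt_eqF//; lra.
  rewrite /potential; under eq_bigr do rewrite /entries mxE -powRrM mulNr mulVf//.
  rewrite mulr0 !mul0r !addr0 powR_inv1 ?(ltW nR)// sumr_const card_ord.
  by rewrite -[_ *+ n]mulr_natl mulfV ?gt_eqF.
- by rewrite mulmx0.
- by rewrite dot0r.
- by rewrite /energy big1 ?expr0n ?mulr0// => i _; rewrite /entries mxE expr0n mulr0.
move=> i; rewrite mxE normr0 mulr_ge0// mxE; exact: powR_ge0.
Qed.

Lemma inv_s_gt0 x nu s X k e : inner_inv x nu s X k e -> forall i, 0 < s i 0.
Proof.
by move=> inv i; apply: lt_le_trans (inv_s inv i); rewrite powR_gt0 ?ltr0n.
Qed.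

(** If the gap exceeded nu/2, a normalized solution z would bound the least energy E by 1 + (3 +
    e/5) + 1, where e <= E. Then E <= 25/4, below the threshold 10. *)
Lemma fail_sound x nu s X k e y v t xs : 0 < nu -> inner_inv x nu s X k e -> k <= T ->
  A *m x = A *m xs ->
  let u := weight q (res_weight p nu x) (entries s) in
  (forall i, u i * y i 0 = (A^T *m v + t *: res_row p nu x) i 0) ->
  ((exists z, direction A (res_row p nu x) z) -> direction A (res_row p nu x) y) ->
  ~ (direction A (res_row p nu x) y /\ energy u (entries y) <= 10) ->
  psum p x - psum p xs <= nu / 2.
Proof.
move=> nu0 inv kT Ax u uy solved fl; rewrite leNgt; apply/negP => gap; apply: fl.
have [z [zd ze zq]] := residual_feasible p2 n0 nu0 Ax gap.
have yd : direction A (res_row p nu x) y by apply: solved; exists z.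
split => //.
have q2 := inner_exp_gt2 p2 n0; have T1 := rounds_ge1 q2 n0.
have u0 : forall i, 0 < u i.
  by apply: weight_gt0 => i; [exact: res_weight_ge0|exact: (inv_s_gt0 inv)].
have Eyz : energy u (entries y) <= energy u (entries z).
  by apply: energy_min => //; apply: (direction_stationary uy).
have Ez := weight_sum_le (res_weight p nu x) (entries z) q2 (inv_s_gt0 inv).
have ey := inv_e inv yd; have pot := inv_pot inv.
have kT1 : k / T <= 1 by rewrite ler_pdivrMr; lra.
have arith (a b c P S h : R) : a <= b -> b <= c + P + S -> e <= a ->
    P <= 1 + 2 * h + e / 5 -> c <= 1 -> S <= 1 -> h <= 1 -> a <= 10.
  by move=> *; lra.
rewrite -mulrA in pot; exact: arith Eyz Ez ey pot ze zq kT1.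
Qed.

Lemma energy_mono (u v y : 'I_n -> R) :
  (forall i, u i <= v i) -> energy u y <= energy v y.
Proof. by move=> uv; apply: ler_sum => i _; rewrite ler_wpM2r ?sqr_ge0. Qed.

(** The bound 5 is 1 from the start, 2 from at most T rounds, and 10/5 from the energy. *)
Lemma inv_pot5 x nu s X k e y : inner_inv x nu s X k e -> k <= T ->
  direction A (res_row p nu x) y ->
  energy (weight q (res_weight p nu x) (entries s)) (entries y) <= 10 ->
  e <= 10 /\ potential q (entries s) <= 5.
Proof.
move=> inv kT yd E10; have q2 := inner_exp_gt2 p2 n0; have T1 := rounds_ge1 q2 n0.
have ey := le_trans (inv_e inv yd) E10; split=> //.
have kT1 : k / T <= 1 by rewrite ler_pdivrMr; lra.
have := inv_pot inv; rewrite -[2 * k / T]mulrA; move: (potential _ _) => P.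
by move: E10 => _; lra.
Qed.

Lemma flow_inv x nu s X k e y : 0 < nu -> inner_inv x nu s X k e -> k <= T ->
  direction A (res_row p nu x) y ->
  energy (weight q (res_weight p nu x) (entries s)) (entries y) <= 10 ->
  \sum_i `|y i 0| `^ q <= width n q ->
  inner_inv x nu (flow_s s y) (X + y) (k + 1) e /\
  potential q (entries (flow_s s y)) <= 7.
Proof.
move=> nu0 inv kT yd E10 yw; have q2 := inner_exp_gt2 p2 n0; have T1 := rounds_ge1 q2 n0.
have s0 := inv_s_gt0 inv.
have w0 := fun i => res_weight_ge0 x i p2 nu0.
have [e10 P5] := inv_pot5 inv kT yd E10.
have K0 : 0 < 45 * q * T by rewrite !mulr_gt0//; lra.
have a0 : 0 < (45 * q * T)^-1 by rewrite invr_gt0.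
have pot : potential q (entries (flow_s s y)) <= potential q (entries s) + 2 / T.
  have := flow_potential q2 T1 w0 s0 P5 E10 yw; apply: le_trans.
  by rewrite le_eqVlt; apply/orP; left; apply/eqP; apply: eq_bigr => i _; rewrite /entries mxE.
have ss i : s i 0 <= flow_s s y i 0.
  by rewrite mxE lerDl mulr_ge0// ltW.
have T2 : 2 / T <= 2 by rewrite ler_pdivrMr; lra.
have k0 := inv_k0 inv.
have [Ay ry] := yd.
split; last by move: pot P5; move: (potential _ _) (potential _ _) => P P' *; move: E10 yw => _ _; lra.
split => //.
- by move: E10 yw => _ _; lra.
- by move=> i; apply: le_trans (inv_s inv i) (ss i).
- exact: inv_e0 inv.
- move=> z zd; apply: le_trans (inv_e inv zd) _; apply: energy_mono => i.
  rewrite /weight lerD2l; apply: powR_lerl; [by move: E10 yw => _ _; lra|exact/ltW/s0|exact: ss].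
- apply: le_trans pot _; have := inv_pot inv.
  rewrite mulrDr mulrDl mulr1; move: (potential _ _) (2 / T) (2 * k / T) => P t2 t3.
  by move: E10 yw => _ _; lra.
- by rewrite mulmxDr (inv_A inv) Ay addr0.
- by rewrite dotDr (inv_row inv) ry.
- have Ey : energy (res_weight p nu x) (entries y) <= 10.
    apply: le_trans E10; apply: energy_mono => i; rewrite /weight lerDl; exact: powR_ge0.
  move: (k0); rewrite le_eqVlt => /predU1P[k00|kpos].
    rewrite -k00 (inv_X0 inv (esym k00)) !add0r expr1n mulr1.
    by [].
  have EX := inv_energy inv.
  (* Convexity of the square with weights k/(k+1) and 1/(k+1): the average X/k keeps energy at most
     10. *)
  have h i : res_weight p nu x i * entries (X + y) i ^+ 2 <=
      (k + 1) / k * (res_weight p nu x i * entries X i ^+ 2) +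
      (k + 1) * (res_weight p nu x i * entries y i ^+ 2).
    rewrite [X in _ <= X + _]mulrCA [X in _ <= _ + X]mulrCA -mulrDr.
    apply: ler_wpM2l => //.
    rewrite /entries !mxE -subr_ge0.
    have -> : (k + 1) / k * X i 0 ^+ 2 + (k + 1) * y i 0 ^+ 2 - (X i 0 + y i 0) ^+ 2 =
              (X i 0 - k * y i 0) ^+ 2 / k by field; rewrite gt_eqF.
    by rewrite divr_ge0 ?sqr_ge0// ltW.
  apply: (le_trans (ler_sum _ (fun i _ => h i))); rewrite big_split/= -!mulr_sumr.
  rewrite -/(energy _ (entries X)) -/(energy _ (entries y)).
  have -> : 10 * (k + 1) ^+ 2 = (k + 1) / k * (10 * k ^+ 2) + (k + 1) * 10.
    by field; rewrite gt_eqF.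
  have k10 : 0 <= k + 1 by rewrite addr_ge0.
  apply: lerD; apply: ler_wpM2l => //; by rewrite divr_ge0.
- by move=> /eqP; rewrite gt_eqF// ltr_wpDl.
move=> i; rewrite !mxE mulrDr mulrA mulfV ?gt_eqF// mul1r.
by apply: le_trans (ler_normD _ _) _; rewrite lerD2r; exact: (inv_X inv).
Qed.

(** The new lower bound is the energy of the current minimizer y plus the gain g. It is at least e +
    g, so e/5 also pays for the potential, which grew by at most g/5. *)
Lemma width_inv x nu s X k e y v t : 0 < nu -> inner_inv x nu s X k e -> k <= T ->
  direction A (res_row p nu x) y ->
  let u := weight q (res_weight p nu x) (entries s) in
  (forall i, u i * y i 0 = (A^T *m v + t *: res_row p nu x) i 0) ->
  energy u (entries y) <= 10 -> width n q < \sum_i `|y i 0| `^ q ->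
  exists2 e', e + min_gain n q <= e' & inner_inv x nu (boost_s s y) X k e'.
Proof.
move=> nu0 inv kT yd u uy E10 yw; have q2 := inner_exp_gt2 p2 n0.
have T1 := rounds_ge1 q2 n0; have s0 := inv_s_gt0 inv.
have w0 := fun i => res_weight_ge0 x i p2 nu0.
have [g [gd gpot gE]] := width_step q2 n0 w0 (inv_s inv) E10 yw.
have ey := inv_e inv yd.
have g0 : 0 <= g.
  apply: le_trans gd; rewrite /min_gain !divr_ge0//; move: E10 yw => _ _; lra.
have bE : entries (boost_s s y) = boost q (congestion q) (entries s) (entries y).
  by apply/funext => i; rewrite /entries mxE.
have ss i : s i 0 <= boost_s s y i 0 by rewrite mxE; exact: boost_ge.
exists (energy u (entries y) + g); first by apply: lerD.
split.
- exact: inv_k0 inv.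
- by move=> i; apply: le_trans (inv_s inv i) (ss i).
- by rewrite addr_ge0// energy_ge0// => i; apply/ltW/weight_gt0.
- by move=> z zd; rewrite bE; apply: gE; exact: (direction_stationary uy).
- rewrite bE; apply: le_trans gpot _; have := inv_pot inv; rewrite -/u in ey.
  move: ey; move: (potential _ _) (energy _ _) (2 * k / T) => P E t2 ey.
  by move: E10 yw => _ _; lra.
- exact: inv_A inv.
- exact: inv_row inv.
- exact: inv_energy inv.
- exact: inv_X0 inv.
move=> i; apply: le_trans (inv_X inv i) _; apply: ler_wpM2l => //.
by rewrite !mulr_ge0//; move: E10 yw => _ _; lra.
Qed.

End Step.

(** * The real-valued measure that bounds the number of iterations *)

Section Measure.
Variables (R : realType) (d n : nat) (A : 'M[R]_(d, n)) (p eps : R) (xs : 'cV[R]_n).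
Local Notation q := (inner_exp p n).
Local Notation T := (rounds n q).
Local Notation lam := (step_scale n p).
Local Notation gain := (min_gain n q).

(** A restart resets the last two terms of [measure] to T + 1 and 11/gain; one more unit pays for
    the iteration itself. *)
Definition solve_budget : R := T + 2 + 11 / gain.

(** A progress step lowers gap/nu by at least 1/(4 lam). Halving nu lowers the binary logarithm by 1
    and doubles gap/nu, which was at most 1/2, so the coefficient 4 lam + 1 outweighs the
    increase. *)
Definition refinements (x : 'cV[R]_n) (nu : R) : R :=
  (4 * lam + 1) * (ln (nu / (eps * psum p xs / (1 + eps))) / ln 2) +
  4 * lam * ((psum p x - psum p xs) / nu).

(** The constant 11 exceeds the energy cap 10 by 1 >= gain, so even the last boost lowers the
    maximum by the full gain. *)
Definition measure (st : iterate R n) (e : R) : R :=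
  solve_budget * refinements (it_x st) (it_nu st) + (T + 1 - it_k st)
  + Num.max 0 (11 - e) / gain.

Definition finished (st : iterate R n) : bool :=
  it_nu st * (1 + eps) <= eps * psum p (it_x st).

Record iterate_inv (st : iterate R n) (e : R) : Prop := IterateInv {
  ii_A : A *m it_x st = A *m xs;
  ii_nu : 0 < it_nu st;
  ii_gap : psum p (it_x st) - psum p xs <= it_nu st;
  ii_kT : it_k st <= T;
  ii_inner : inner_inv A p (it_x st) (it_nu st) (it_s st) (it_X st) (it_k st) e
}.

Hypotheses (p2 : 2 <= p) (n0 : (0 < n)%N) (eps0 : 0 < eps).
Hypothesis xs_opt : forall x, A *m x = A *m xs -> psum p xs <= psum p x.
Hypothesis xs_gt0 : 0 < psum p xs.

Lemma gain_gt0 : 0 < gain.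
Proof.
have q2 := inner_exp_gt2 p2 n0; have T1 := rounds_ge1 q2 n0.
rewrite /min_gain !divr_gt0//; lra.
Qed.

Lemma gain_le1 : gain <= 1.
Proof.
have q2 := inner_exp_gt2 p2 n0; have T1 := rounds_ge1 q2 n0.
rewrite /min_gain ler_pdivrMr; last lra.
rewrite ler_pdivrMr; last lra.
apply: (@le_trans _ _ (1 * (2 * (q + 1)))); first lra.
rewrite mul1r ler_peMl//; lra.
Qed.

Lemma lam_gt0 : 0 < lam.
Proof.
have q2 := inner_exp_gt2 p2 n0; have p2' := p2.
by rewrite /step_scale !mulr_gt0 ?exprn_gt0//; lra.
Qed.

(** Before the stopping test holds, nu exceeds eps/(1+eps) times the current value, hence times the
    optimum, and the logarithm is nonnegative. *)
Lemma measure_ge0 st e : iterate_inv st e -> ~~ finished st -> 0 <= measure st e.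
Proof.
move=> inv; rewrite /finished -ltNge => nf.
have q2 := inner_exp_gt2 p2 n0; have T1 := rounds_ge1 q2 n0.
have g0 := gain_gt0; have l0 := lam_gt0.
have ln2 : 0 < ln (2 : R) by rewrite ln_gt0// ltr1n.
have opt := xs_opt (ii_A inv).
have nu0 := ii_nu inv.
rewrite /measure addr_ge0//; last first.
  by rewrite divr_ge0 ?(ltW g0)// le_max lexx.
rewrite addr_ge0//; last by rewrite subr_ge0 (le_trans (ii_kT inv))// lerDl.
rewrite mulr_ge0//.
  by rewrite addr_ge0 ?divr_ge0 ?(ltW g0)//; move: nf => _; lra.
rewrite /refinements; apply: addr_ge0; apply: mulr_ge0.
- by move: nf => _; lra.
- have pos : 0 < eps * psum p xs / (1 + eps).
    by rewrite !mulr_gt0// invr_gt0 addr_gt0.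
  rewrite divr_ge0 ?(ltW ln2)// ln_ge0// ler_pdivlMr// mul1r.
  rewrite ler_pdivrMr ?addr_gt0//; apply: le_trans (ltW nf).
  by apply: ler_wpM2l => //; exact: ltW.
- by move: nf => _; lra.
by rewrite divr_ge0 ?subr_ge0// ltW.
Qed.

Lemma restart_measure x nu x' nu' k e : k <= T ->
  refinements x' nu' + 1 <= refinements x nu ->
  forall s X, measure (restart p x' nu') 0 + 1 <= measure (Iterate x nu s X k) e.
Proof.
move=> kT ref s X; have g0 := gain_gt0.
have q2 := inner_exp_gt2 p2 n0; have T1 := rounds_ge1 q2 n0.
have B0 : 0 <= solve_budget.
  by rewrite addr_ge0 ?divr_ge0 ?(ltW g0)//; lra.
rewrite /measure /=.
have m0 : 0 <= Num.max 0 (11 - e) / gain by rewrite divr_ge0 ?(ltW g0)// le_max lexx.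
have := ler_wpM2l B0 ref; rewrite mulrDr mulr1.
rewrite !subr0 (@max_r _ _ 0 11)// {2}/solve_budget.
move: m0; move: (Num.max _ _ / _) (11 / gain) (refinements _ _) (refinements _ _) => M G r1 r2.
lra.
Qed.

Lemma next_iterate_inv st e (y : 'cV[R]_n) v t : iterate_inv st e ->
  (forall i, cur_weight p st i * y i 0 =
     (A^T *m v + t *: res_row p (it_nu st) (it_x st)) i 0) ->
  ((exists z, direction A (res_row p (it_nu st) (it_x st)) z) ->
     direction A (res_row p (it_nu st) (it_x st)) y) ->
  exists2 e', iterate_inv (next_iterate A p st y) e' &
    measure (next_iterate A p st y) e' + 1 <= measure st e.
Proof.
case: st => x nu s X k [/= Ax nu0 gap kT inv] uy solved.
have l0 := lam_gt0.
have q2 := inner_exp_gt2 p2 n0; have T1 := rounds_ge1 q2 n0.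
have ln2 : 0 < ln (2 : R) by rewrite ln_gt0// ltr1n.
have T0 : 0 <= T by lra.
(* A vector that is not a direction and an energy above 10 are treated alike: either one shows that
   the gap is at most nu/2. *)
have failing : ~ (direction A (res_row p nu x) y /\
    energy (cur_weight p (Iterate x nu s X k)) (entries y) <= 10) ->
  exists2 e', iterate_inv (restart p x (nu / 2)) e' &
    measure (restart p x (nu / 2)) e' + 1 <= measure (Iterate x nu s X k) e.
  move=> fl; have gap2 := fail_sound p2 n0 nu0 inv kT Ax uy solved fl.
  have nu20 : 0 < nu / 2 by rewrite divr_gt0.
  exists 0; first by split => //; exact: start_inv.
  apply: restart_measure => //; rewrite /refinements.
  have pos : 0 < eps * psum p xs / (1 + eps).
    by rewrite !mulr_gt0// invr_gt0 addr_gt0.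
  have -> : nu / 2 / (eps * psum p xs / (1 + eps)) =
            nu / (eps * psum p xs / (1 + eps)) / 2 by rewrite mulrAC.
  have pos' : 0 < nu / (eps * psum p xs / (1 + eps)) by rewrite divr_gt0.
  rewrite (@lnM R (nu / _) 2^-1) ?posrE ?invr_gt0//.
  rewrite (@lnV R 2) ?posrE//.
  move: gap2; move: (ln (nu / _)) (psum p x - psum p xs) => a g g2.
  have -> : (a - ln 2) / ln 2 = a / ln 2 - 1 by field; rewrite gt_eqF.
  have -> : g / (nu / 2) = 2 * (g / nu) by field; rewrite gt_eqF.
  have : g / nu <= 2^-1 by rewrite ler_pdivrMr//; move: l0 uy solved fl => _ _ _ _; lra.
  move: (a / ln 2) (g / nu) l0 => b h; move: uy solved fl => _ _ _.
  move=> l0 h2; have : 4 * lam * (2 * h) - 4 * lam * h = 4 * lam * h by ring.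
  have : 4 * lam * h <= 4 * lam * 2^-1 by rewrite ler_pM2l// mulr_gt0.
  lra.
rewrite /next_iterate; case: ifP => [/violation_direction yd|/negP h]; last first.
  by apply: failing => -[/violation_direction].
case: ifP => [E10|/negP h]; last by apply: failing => -[].
case: ifP => [yw|/negbT]; last first.
  rewrite -ltNge => yw.
  have [e' ee' inv'] := width_inv p2 n0 nu0 inv kT yd uy E10 yw.
  exists e'; first by split.
  have [e10 _] := inv_pot5 p2 n0 inv kT yd E10.
  have g0 := gain_gt0; have g1 := gain_le1.
  rewrite /measure /= -addrA lerD2l -lerBrDr.
  have -> : Num.max 0 (11 - e) = 11 - e by rewrite max_r//; move: uy solved failing yw E10 => _ _ _ _ _; lra.
  rewrite ler_pdivrMr// mulrBl divfK ?gt_eqF// mul1r ge_max.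
  by apply/andP; split; move: uy solved failing yw E10 => _ _ _ _ _; lra.
have [inv' P7] := flow_inv p2 n0 nu0 inv kT yd E10 yw.
case: ifP => [Tk|/negbT]; last first.
  rewrite -ltNge => kT'; exists e; first by split => //; exact: ltW.
  by rewrite /measure /=; move: uy solved failing yw E10 P7 => _ _ _ _ _ _; lra.
have k0 : 0 < k + 1 by apply: lt_le_trans Tk; lra.
have prog := residual_progress p2 n0 nu0 k0 (inv_row inv') (inv_energy inv').
have {prog} := prog (entries (flow_s p s y)).
move=> /(_ _ P7) prog.
have {}prog := prog _.
have {}prog : psum p (x + (sigma p nu / (lam * (k + 1))) *: (X + y)) <=
    psum p x - nu / (4 * lam).
  (* [inv_X] bounds X through T, whereas the step divides by k + 1; success is declared only when T
     <= k + 1. *)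
  apply: prog => i; apply: le_trans (inv_X inv' i) _.
  apply: ler_wpM2r; first exact/ltW/(inv_s_gt0 n0 inv').
  by apply: ler_wpM2l => //; rewrite mulr_ge0//; lra.
have gl : 0 <= nu / (4 * lam) by rewrite divr_ge0 ?(ltW nu0)// mulr_ge0// ltW.
exists 0.
  split => //=; last exact: start_inv.
    by rewrite mulmxDr -scalemxAr (inv_A inv') scaler0 addr0.
  by move: prog gap gl; move: (psum _ _) (psum _ _) (psum _ _) (nu / _) => a b c g; lra.
apply: restart_measure => //; rewrite /refinements.
set x' := x + _ in prog *.
rewrite -addrA lerD2l.
have -> : 4 * lam * ((psum p x' - psum p xs) / nu) + 1 =
   4 * lam / nu * (psum p x' - psum p xs + nu / (4 * lam)).
  by field; rewrite !gt_eqF.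
have -> : 4 * lam * ((psum p x - psum p xs) / nu) = 4 * lam / nu * (psum p x - psum p xs).
  by field; rewrite !gt_eqF.
apply: ler_wpM2l; first by rewrite divr_ge0 ?(ltW nu0)// mulr_ge0// ltW.
by move: prog; move: (psum _ _) (psum _ _) (psum _ _) (nu / _) => a b c g; lra.
Qed.

End Measure.

(** * The program *)

(* Scalars: 4-21 constants (see [constants]), 22 nu, 23 k, 24 the stopping flag,
   25 the loop counter, 26 sigma, 31-33 the tests of [update]. n-vectors: 0 x, 1 s,
   2 X, 3 the weights, 6 the appended row, 7 the inverse weights, 8 y, 9 |y|; 4 is
   constantly 1/2, absolute values being computed as (v * v)^(1/2). *)

Definition block (I : Type) (inj : basic -> I) (ops : seq basic) : prog I :=
  foldr (fun a c => Seq (Do (inj a)) c) (Skip I) ops.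

Definition restart_ops : seq basic := [:: NFill 1 13; NFill 2 4; SConst 23 0].

Definition psum_ops (i : nat) : seq basic :=
  [:: NOp OpMul 5 0 0; NOp OpPow 5 5 4; NFill 10 0; NOp OpPow 5 5 10; NSum i 5].

Definition finished_ops : seq basic :=
  psum_ops 34 ++ [:: SOp OpMul 34 1 34; SOp OpMul 35 22 20; SOp OpLe 24 35 34].

Definition system_ops : seq basic :=
  [:: SOp OpDiv 26 22 6; SOp OpPow 26 26 21; SOp OpMul 26 19 26;
      NOp OpMul 3 0 0; NOp OpPow 3 3 4; NFill 5 15; NOp OpPow 3 3 5;
      SOp OpMul 27 6 26; SOp OpDiv 27 27 22; SOp OpSub 27 4 27;
      SOp OpMul 27 27 0; NFill 5 27; NOp OpMul 6 3 0; NOp OpMul 6 5 6;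
      SOp OpMul 28 26 26; SOp OpMul 28 28 0; SOp OpMul 29 6 22;
      SOp OpDiv 28 28 29; NFill 5 28; NOp OpMul 3 5 3;
      NFill 5 16; NOp OpPow 5 1 5; NOp OpAdd 3 3 5;
      NFill 5 5; NOp OpDiv 7 5 3].

Definition direction_ops : seq basic :=
  [:: MulAT 8 1; NFill 5 30; NOp OpMul 5 5 6; NOp OpAdd 8 8 5; NOp OpMul 8 7 8].

Definition test_ops : seq basic :=
  [:: MulA 2 8; DOp OpMul 2 2 2; DSum 31 2; NOp OpMul 5 6 8; NSum 32 5;
      SOp OpSub 32 32 5; SOp OpMul 32 32 32; SOp OpAdd 31 31 32;
      NOp OpMul 5 8 8; NOp OpMul 5 3 5; NSum 32 5;
      NOp OpMul 9 8 8; NOp OpPow 9 9 4; NFill 5 7; NOp OpPow 5 9 5; NSum 33 5].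

Definition fail_ops : seq basic := SOp OpDiv 22 22 6 :: restart_ops.

Definition flow_ops : seq basic :=
  [:: NFill 5 12; NOp OpMul 5 5 9; NOp OpAdd 1 1 5; NOp OpAdd 2 2 8;
      SOp OpAdd 23 23 5].

Definition success_ops : seq basic :=
  [:: SOp OpMul 34 11 23; SOp OpDiv 34 26 34; NFill 5 34; NOp OpMul 5 5 2;
      NOp OpAdd 0 0 5] ++ restart_ops.

Definition boost_ops : seq basic :=
  [:: NFill 5 10; NOp OpMul 5 5 1; NOp OpLe 5 5 9; NFill 10 17; NOp OpMul 5 5 10;
      NFill 10 5; NOp OpAdd 5 10 5; NOp OpMul 1 1 5].

Definition sub_block := block SubBasic.

Definition update : prog sub_instr :=
  If 31 4
    (If 32 14
      (If 33 9
        (Seq (sub_block flow_ops) (If 8 23 (sub_block success_ops) (Skip _)))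
        (sub_block boost_ops))
      (sub_block fail_ops))
    (sub_block fail_ops).

Definition iteration : prog sub_instr :=
  Seq (sub_block system_ops)
 (Seq (Do (Solve 6 7 5 1 30))
 (Seq (sub_block (direction_ops ++ test_ops))
 (Seq update
      (sub_block finished_ops)))).

(** Once the stopping flag is set, the remaining passes only advance the counter, leaving x
    intact. *)
Definition loop_body : prog sub_instr :=
  Seq (If 24 4 iteration (Skip _)) (sub_block [:: SOp OpAdd 25 25 5]).

(** The counter starts at 1 and runs while it is at most T, hence exactly floor T passes. *)
Definition subproblem : prog sub_instr :=
  Seq (sub_block [:: SConst 25 1]) (While 25 8 loop_body).

(** The minimum and maximum in [inner_exp] are computed without branching, as in p + [p <= m] (m -
    p). *)
Definition constant_ops : seq basic :=
  [:: SConst 4 0; SConst 5 1; SConst 6 2; SConst 14 10; SConst 19 16;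
      SOp OpDiv 18 5 6;
      SLn 26 2; SOp OpAdd 26 5 26; SOp OpDiv 27 5 26; SOp OpAdd 27 6 27;
      SOp OpAdd 28 6 26;
      SOp OpLe 29 0 27; SOp OpSub 30 27 0; SOp OpMul 30 29 30; SOp OpAdd 30 0 30;
      SOp OpLe 29 30 28; SOp OpSub 31 30 28; SOp OpMul 31 29 31; SOp OpAdd 7 28 31].

Definition parameter_ops : seq basic :=
  [:: SOp OpSub 16 7 6; SConst 29 3; SOp OpMul 29 29 7; SOp OpSub 29 29 6;
      SOp OpDiv 29 16 29; SOp OpPow 8 2 29;
      SOp OpSub 29 7 5; SOp OpPow 29 8 29; SConst 30 15; SOp OpPow 30 30 7;
      SOp OpMul 9 29 30;
      SConst 29 30; SOp OpAdd 30 7 5; SOp OpMul 29 29 30; SOp OpDiv 29 29 16;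
      SOp OpPow 10 29 18;
      SConst 29 12; SOp OpPow 29 14 29; SOp OpMul 29 29 0; SOp OpMul 11 29 7;
      SConst 29 45; SOp OpMul 29 29 7; SOp OpMul 29 29 8; SOp OpDiv 12 5 29;
      SOp OpDiv 17 5 7; SOp OpSub 29 4 17; SOp OpPow 13 2 29;
      SOp OpSub 15 0 6; SOp OpAdd 20 5 1; SOp OpDiv 21 5 0; NFill 4 18].

Definition initial_ops : seq basic :=
  MulAT 0 1 :: psum_ops 22 ++ restart_ops ++ finished_ops
            ++ [:: SOp OpMul 29 20 20].

Definition main_block := block MainBasic.

(** The guard is n <= (1 + eps)^2: then the least-squares point, within a factor n^(1/2) of optimal,
    is already accurate enough. This includes n = 1, where the claimed number of subproblems is
    0. *)
Definition regression : algorithm :=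
  Seq (main_block (constant_ops ++ parameter_ops))
 (Seq (Do (LeastSquares 1))
 (Seq (main_block initial_ops)
      (If 2 29 (Skip _) (While 24 4 (Do (Subproblem subproblem)))))).

(** * What each block of instructions computes *)

Section Execution.
Variables (R : realType) (d n : nat) (A : 'M[R]_(d, n)) (b : 'cV[R]_d).
Variable solve : forall m, 'M[R]_m -> 'cV[R]_m -> 'cV[R]_m.
Variables (p eps : R).
Local Notation state := (state R n d).
Local Notation q := (inner_exp p n).
Local Notation T := (rounds n q).
Local Notation lam := (step_scale n p).

Definition run_ops (ops : seq basic) (s : state) : state :=
  foldl (fun s a => eval_basic A a s) s ops.

Lemma exec_sub_block ops s :
  exec (sub_step A solve) (sub_block ops) s (nseq (size ops) SubOp) (run_ops ops s).
Proof.
elim: ops s => [|a ops ih] s /=; first exact: exec_Skip.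
apply: (@exec_Seq _ _ _ _ _ _ _ _ _ [:: SubOp]); last exact: ih.
by apply: exec_Do; exact: step_SubBasic.
Qed.

Lemma exec_main_block ops s :
  exec (main_step A b solve) (main_block ops) s (nseq (size ops) MainOp) (run_ops ops s).
Proof.
elim: ops s => [|a ops ih] s /=; first exact: exec_Skip.
apply: (@exec_Seq _ _ _ _ _ _ _ _ _ [:: MainOp]); last exact: ih.
by apply: exec_Do; exact: step_MainBasic.
Qed.

(* Registers are read back through the reversed program, so that evaluating one
   of them only unfolds the instructions that it depends on. *)
Fixpoint get_s (rops : seq basic) (s : state) (l : nat) {struct rops} : R :=
  if rops is a :: r then
    match a with
    | SConst i c => if eqn l i then c%:R else get_s r s l
    | SLn i j => if eqn l i then ln (get_s r s j) else get_s r s l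
    | SOp o i j k =>
      if eqn l i then eval_binop o (get_s r s j) (get_s r s k) else get_s r s l
    | NSum i j => if eqn l i then \sum_k get_n r s j k else get_s r s l
    | DSum i j => if eqn l i then \sum_k get_d r s j k else get_s r s l
    | _ => get_s r s l
    end
  else sreg s l
with get_n (rops : seq basic) (s : state) (l : nat) (m : 'I_n) {struct rops} : R :=
  if rops is a :: r then
    match a with
    | NFill i j => if eqn l i then get_s r s j else get_n r s l m
    | NOp o i j k =>
      if eqn l i then eval_binop o (get_n r s j m) (get_n r s k m) else get_n r s l m
    | MulAT i j => if eqn l i then \sum_k A k m * get_d r s j k else get_n r s l m
    | _ => get_n r s l m
    end
  else nreg s l m 0
with get_d (rops : seq basic) (s : state) (l : nat) (m : 'I_d) {struct rops} : R :=
  if rops is a :: r then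
    match a with
    | DFill i j => if eqn l i then get_s r s j else get_d r s l m
    | DOp o i j k =>
      if eqn l i then eval_binop o (get_d r s j m) (get_d r s k m) else get_d r s l m
    | MulA i j => if eqn l i then \sum_k A m k * get_n r s j k else get_d r s l m
    | _ => get_d r s l m
    end
  else dreg s l m 0.

Lemma getE ops s :
  [/\ forall l, sreg (run_ops ops s) l = get_s (rev ops) s l,
      forall l m, nreg (run_ops ops s) l m 0 = get_n (rev ops) s l m &
      forall l m, dreg (run_ops ops s) l m 0 = get_d (rev ops) s l m].
Proof.
elim/last_ind: ops => [//|ops a]; rewrite /run_ops rev_rcons foldl_rcons -/(run_ops ops s).
move: (run_ops ops s) (rev ops) => s' r [hs hn hd].
by case: a => [i c|i j|o i j k|i j|o i j k|i j|i j|o i j k|i j|i j|i j];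
  split=> l *; rewrite /= /upd -?eqnE ?hs ?hn ?hd//;
  case: ifP => _; rewrite ?hs ?hn ?hd// ?mxE ?hs ?hn ?hd//;
  apply: eq_bigr => k' _; rewrite ?mxE ?hn ?hd.
Qed.

Lemma run_sE ops s l : sreg (run_ops ops s) l = get_s (rev ops) s l.
Proof. by have [] := getE ops s. Qed.

Lemma run_nE ops s l m : nreg (run_ops ops s) l m 0 = get_n (rev ops) s l m.
Proof. by have [] := getE ops s. Qed.

Record constants (s : state) : Prop := Constants {
  c_p : sreg s 0 = p;
  c_eps : sreg s 1 = eps;
  c_n : sreg s 2 = n%:R;
  c_0 : sreg s 4 = 0;
  c_1 : sreg s 5 = 1;
  c_2 : sreg s 6 = 2;
  c_q : sreg s 7 = q;
  c_T : sreg s 8 = T;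
  c_width : sreg s 9 = width n q;
  c_cong : sreg s 10 = congestion q;
  c_lam : sreg s 11 = lam;
  c_a : sreg s 12 = (45 * q * T)^-1;
  c_start : sreg s 13 = n%:R `^ (- q^-1);
  c_10 : sreg s 14 = 10;
  c_p2 : sreg s 15 = p - 2;
  c_q2 : sreg s 16 = q - 2;
  c_qV : sreg s 17 = q^-1;
  c_16 : sreg s 19 = 16;
  c_1eps : sreg s 20 = 1 + eps;
  c_pV : sreg s 21 = p^-1;
  c_half : forall i, nreg s 4 i 0 = 2^-1
}.

Record represents (st : iterate R n) (s : state) : Prop := Represents {
  r_x : forall i, nreg s 0 i 0 = it_x st i 0;
  r_s : forall i, nreg s 1 i 0 = it_s st i 0;
  r_X : forall i, nreg s 2 i 0 = it_X st i 0;
  r_nu : sreg s 22 = it_nu st;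
  r_k : sreg s 23 = it_k st
}.

Lemma sqr_powR_half (x : R) : (x * x) `^ 2^-1 = `|x|.
Proof. by rewrite -expr2 powR12_sqrt ?sqr_ge0// sqrtr_sqr. Qed.

Ltac evaluate := rewrite ?run_sE ?run_nE;
  lazy [get_s get_n get_d rev catrev cat eqn eval_binop
    system_ops direction_ops test_ops fail_ops flow_ops success_ops boost_ops restart_ops
    finished_ops psum_ops constant_ops parameter_ops initial_ops].

Lemma constants_frame s s' :
  (forall l, (l < 22)%N -> sreg s' l = sreg s l) ->
  (forall i, nreg s' 4 i 0 = nreg s 4 i 0) -> constants s -> constants s'.
Proof.
move=> hs hn [*]; split; rewrite ?hs//.
by move=> i; rewrite hn.
Qed.

Definition constant_free (a : basic) : bool :=
  match a with
  | SConst i _ | SLn i _ | SOp _ i _ _ | NSum i _ | DSum i _ => (21 < i)%N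
  | NFill i _ | NOp _ i _ _ | MulAT i _ => (i != 4)%N
  | _ => true
  end.

Lemma constants_run ops s :
  constants s -> all constant_free ops -> constants (run_ops ops s).
Proof.
elim: ops s => [//|a ops ih] s c /= /andP[ha hops]; apply: ih => //.
apply: constants_frame c => [l l22|m];
  case: a ha => [i ?|i ?|? i ? ?|i ?|? i ? ?|i ?|i ?|? i ? ?|i ?|i ?|i ?] //= hi;
  rewrite /upd ifF//; first [by rewrite ltn_eqF// (leq_trans l22)
                            |by apply/negbTE; rewrite eq_sym].
Qed.

Lemma system_ops_spec st s : constants s -> represents st s ->
  let s' := run_ops system_ops s in
  [/\ constants s', represents st s', sreg s' 25 = sreg s 25,
      sreg s' 26 = sigma p (it_nu st) &
      [/\ nreg s' 6 = res_row p (it_nu st) (it_x st),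
          nreg s' 3 = \col_i cur_weight p st i &
          nreg s' 7 = \col_i (cur_weight p st i)^-1]].
Proof.
move=> c r s'.
have s26 : sreg s' 26 = sigma p (it_nu st).
  by evaluate; rewrite (c_16 c) (c_2 c) (c_pV c) (r_nu r).
have s3 i : nreg s' 3 i 0 = cur_weight p st i.
  evaluate.
  rewrite (c_16 c) (c_2 c) (c_pV c) (r_nu r) (c_p c) (c_p2 c) (c_q2 c).
  rewrite (c_half c) (r_x r) (r_s r) sqr_powR_half.
  by rewrite /cur_weight /weight /res_weight /pweight /entries /sigma expr2.
split; [|by case: r => *; split=> *; evaluate|by evaluate|exact: s26|split].
- exact: constants_run.
- apply/matrixP => i j; rewrite (ord1 j); evaluate.
  rewrite (c_16 c) (c_2 c) (c_pV c) (r_nu r) (c_p c) (c_p2 c) (c_0 c).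
  rewrite (c_half c) (r_x r) sqr_powR_half sub0r !mxE.
  by rewrite /pweight /sigma -!mulrA.
- by apply/matrixP => i j; rewrite (ord1 j) s3 mxE.
apply/matrixP => i j; rewrite (ord1 j) [RHS]mxE.
transitivity (sreg s 5 / nreg s' 3 i 0); last by rewrite (c_1 c) s3 div1r.
by evaluate.
Qed.

Lemma direction_ops_spec st s (r u v : 'cV[R]_n) (phi : 'cV[R]_(d + 1)) :
   constants s -> represents st s ->
  nreg s 6 = r -> nreg s 3 = u -> nreg s 7 = v ->
  sreg s 30 = dsubmx phi 0 0 -> dreg s 1 = usubmx phi ->
  let s' := run_ops direction_ops s in
  [/\ constants s', represents st s', sreg s' 25 = sreg s 25, sreg s' 26 = sreg s 26 &
   [/\ nreg s' 6 = r, nreg s' 3 = u &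
       nreg s' 8 = \col_i (v i 0 * (A^T *m usubmx phi + dsubmx phi 0 0 *: r) i 0)]].
Proof.
move=> c rp h6 h3 h7 h30 h1 s'.
split; [exact: constants_run|by case: rp => *; split=> *; evaluate|by evaluate|by evaluate|split].
- by rewrite -h6; apply/matrixP => i j; rewrite (ord1 j); evaluate.
- by rewrite -h3; apply/matrixP => i j; rewrite (ord1 j); evaluate.
apply/matrixP => i j; rewrite (ord1 j); evaluate.
rewrite h6 h7 h30 h1 !mxE; congr (_ * (_ + _)).
by apply: eq_bigr => k _; rewrite !mxE.
Qed.

Lemma test_ops_spec st s (r u y : 'cV[R]_n) : constants s -> represents st s ->
  nreg s 6 = r -> nreg s 3 = u -> nreg s 8 = y ->
  let s' := run_ops test_ops s in
  [/\ constants s', represents st s', sreg s' 25 = sreg s 25, sreg s' 26 = sreg s 26 &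
   [/\ nreg s' 8 = y, (forall i, nreg s' 9 i 0 = `|y i 0|),
      sreg s' 31 = violation A r y, sreg s' 32 = energy (entries u) (entries y) &
      sreg s' 33 = \sum_i `|y i 0| `^ q]].
Proof.
move=> c rp h6 h3 h8 s'.
split; [exact: constants_run|by case: rp => *; split=> *; evaluate|by evaluate|by evaluate|split].
- by rewrite -h8; apply/matrixP => i j; rewrite (ord1 j); evaluate.
- by move=> i; evaluate; rewrite (c_half c) h8 sqr_powR_half.
- evaluate; rewrite h6 h8 (c_1 c) -expr2; congr (_ + _).
  by apply: eq_bigr => j _; rewrite mxE expr2.
- by evaluate; rewrite h3 h8; apply: eq_bigr => i _; rewrite expr2.
evaluate; rewrite h8 (c_q c); apply: eq_bigr => i _.
by rewrite (c_half c) sqr_powR_half.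
Qed.

Lemma fail_ops_spec st s : constants s -> represents st s ->
  let s' := run_ops fail_ops s in
  [/\ constants s', represents (restart p (it_x st) (it_nu st / 2)) s' &
      sreg s' 25 = sreg s 25].
Proof.
move=> c r s'; split; [exact: constants_run| |by evaluate].
by split=> [i|i|i||]; evaluate;
  rewrite ?(r_x r) ?(c_start c) ?(c_0 c) ?(r_nu r) ?(c_2 c) ?mxE.
Qed.

Lemma flow_ops_spec st s y : constants s -> represents st s ->
  nreg s 8 = y -> (forall i, nreg s 9 i 0 = `|y i 0|) ->
  let s' := run_ops flow_ops s in
  [/\ constants s', represents (Iterate (it_x st) (it_nu st) (flow_s p (it_s st) y)
         (it_X st + y) (it_k st + 1)) s', sreg s' 25 = sreg s 25 &
      sreg s' 26 = sreg s 26].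
Proof.
move=> c r h8 h9 s'; split; [exact: constants_run| |by evaluate|by evaluate].
by split=> [i|i|i||]; evaluate;
  rewrite ?(r_x r) ?(r_s r) ?(r_X r) ?(r_nu r) ?(r_k r) ?(c_a c) ?(c_1 c) ?h8 ?h9 ?mxE.
Qed.

Lemma success_ops_spec st s : constants s -> represents st s ->
  sreg s 26 = sigma p (it_nu st) ->
  let s' := run_ops success_ops s in
  [/\ constants s', represents (restart p
         (it_x st + (sigma p (it_nu st) / (lam * it_k st)) *: it_X st) (it_nu st)) s' &
      sreg s' 25 = sreg s 25].
Proof.
move=> c r h s'; split; [exact: constants_run| |by evaluate].
by split=> [i|i|i||]; evaluate;
  rewrite ?(r_x r) ?(r_X r) ?(r_k r) ?(c_lam c) ?(c_start c) ?(c_0 c) ?(r_nu r) ?h ?mxE.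
Qed.

Lemma boost_ops_spec st s (y : 'cV[R]_n) : constants s -> represents st s ->
  (forall i, nreg s 9 i 0 = `|y i 0|) ->
  let s' := run_ops boost_ops s in
  [/\ constants s', represents (Iterate (it_x st) (it_nu st) (boost_s p (it_s st) y)
         (it_X st) (it_k st)) s' & sreg s' 25 = sreg s 25].
Proof.
move=> c r h9 s'; split; [exact: constants_run| |by evaluate].
by split=> [i|i|i||]; evaluate;
  rewrite ?(r_x r) ?(r_s r) ?(r_X r) ?(r_nu r) ?(r_k r) ?(c_cong c) ?(c_1 c) ?(c_qV c) ?h9 ?mxE.
Qed.

Lemma finished_ops_spec st s : constants s -> represents st s ->
  let s' := run_ops finished_ops s in
  [/\ constants s', represents st s', sreg s' 25 = sreg s 25,
      sreg s' 24 = (finished p eps st)%:R & sreg s' 20 = sreg s 20].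
Proof.
move=> c r s'; split; [exact: constants_run|by case: r => *; split=> *; evaluate|by evaluate| |by evaluate].
evaluate; rewrite (c_eps c) (r_nu r) (c_1eps c) (c_p c) /finished /psum.
by under eq_bigr do rewrite (c_half c) (r_x r) sqr_powR_half.
Qed.

Lemma update_exec st s y : constants s -> represents st s ->
  sreg s 26 = sigma p (it_nu st) -> nreg s 8 = y ->
  (forall i, nreg s 9 i 0 = `|y i 0|) ->
  sreg s 31 = violation A (res_row p (it_nu st) (it_x st)) y ->
  sreg s 32 = energy (cur_weight p st) (entries y) ->
  sreg s 33 = \sum_i `|y i 0| `^ q ->
  exists t s', [/\ exec (sub_step A solve) update s t s', constants s',
    represents (next_iterate A p st y) s', sreg s' 25 = sreg s 25 &
    count is_solve_call t = 0%N /\ (count is_sub_op t <= 20)%N].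
Proof.
move=> c r h26 h8 h9 h31 h32 h33.
have [cf rf f25] := fail_ops_spec c r.
case: st r h26 h31 h32 h33 rf => x nu s0 X k r h26 h31 h32 h33 rf; rewrite /next_iterate.
case: ifP => hv; last first.
  exists (nseq (size fail_ops) SubOp), (run_ops fail_ops s); split => //.
  by apply: exec_IfF; [rewrite h31 (c_0 c) ltNge hv|exact: exec_sub_block].
case: ifP => hE; last first.
  exists (nseq (size fail_ops) SubOp), (run_ops fail_ops s); split => //.
  apply: exec_IfT; first by rewrite h31 (c_0 c).
  by apply: exec_IfF; [rewrite h32 (c_10 c) ltNge hE|exact: exec_sub_block].
case: ifP => hw; last first.
  have [cb rb b25] := boost_ops_spec c r h9.
  exists (nseq (size boost_ops) SubOp), (run_ops boost_ops s); split => //.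
  apply: exec_IfT; first by rewrite h31 (c_0 c).
  apply: exec_IfT; first by rewrite h32 (c_10 c).
  by apply: exec_IfF; [rewrite h33 (c_width c) ltNge hw|exact: exec_sub_block].
have [cw rw w25 w26] := flow_ops_spec c r h8 h9.
case: ifP => hT; last first.
  exists (nseq (size flow_ops) SubOp ++ [::]), (run_ops flow_ops s); split => //.
  apply: exec_IfT; first by rewrite h31 (c_0 c).
  apply: exec_IfT; first by rewrite h32 (c_10 c).
  apply: exec_IfT; first by rewrite h33 (c_width c).
  apply: exec_Seq (exec_sub_block _ _) _.
  by apply: exec_IfF; [rewrite (c_T cw) (r_k rw) ltNge hT|exact: exec_Skip].
have [cs rs s25] := success_ops_spec cw rw (etrans w26 h26).
exists (nseq (size flow_ops) SubOp ++ nseq (size success_ops) SubOp),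
  (run_ops success_ops (run_ops flow_ops s)); split => //.
- apply: exec_IfT; first by rewrite h31 (c_0 c).
  apply: exec_IfT; first by rewrite h32 (c_10 c).
  apply: exec_IfT; first by rewrite h33 (c_width c).
  apply: exec_Seq (exec_sub_block _ _) _.
  by apply: exec_IfT; [rewrite (c_T cw) (r_k rw)|exact: exec_sub_block].
Qed.

Lemma constant_ops_spec s : s = initial_state n b p eps ->
  let s' := run_ops constant_ops s in
  [/\ sreg s' 0 = p, sreg s' 1 = eps, sreg s' 2 = n%:R, sreg s' 4 = 0 &
   [/\ sreg s' 5 = 1, sreg s' 6 = 2, sreg s' 14 = 10, sreg s' 19 = 16 &
       sreg s' 18 = 2^-1 /\ sreg s' 7 = q]].
Proof.
move=> sE s'.
have h0 : sreg s 0 = p by rewrite sE.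
have h1 : sreg s 1 = eps by rewrite sE.
have h2 : sreg s 2 = n%:R by rewrite sE.
clear sE.
split; [by evaluate|by evaluate|by evaluate|by evaluate|].
split; [by evaluate|by evaluate|by evaluate|by evaluate|split].
  by evaluate; rewrite div1r.
evaluate; rewrite h0 h2 div1r /inner_exp /log_cap.
set l := 1 + ln _; set m := 2 + l^-1; set u := 2 + l.
have -> : p + (p <= m)%R%:R * (m - p) = Num.max p m.
  by case: (leP p m) => _; rewrite ?mul1r ?mul0r ?addr0// addrC subrK.
by case: (leP (Num.max p m) u) => _; rewrite ?mul1r ?mul0r ?addr0// addrC subrK.
Qed.

Lemma parameter_ops_spec (s : state) :
  sreg s 0 = p -> sreg s 1 = eps -> sreg s 2 = n%:R -> sreg s 4 = 0 -> sreg s 5 = 1 ->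
  sreg s 6 = 2 -> sreg s 14 = 10 -> sreg s 19 = 16 -> sreg s 18 = 2^-1 -> sreg s 7 = q ->
  constants (run_ops parameter_ops s).
Proof.
move=> h0 h1 h2 h4 h5 h6 h14 h19 h18 h7.
split; last move=> i; evaluate; rewrite ?h0 ?h1 ?h2 ?h4 ?h5 ?h6 ?h14 ?h19 ?h18 ?h7 ?div1r ?sub0r//.
by rewrite (powR_mulrn 12).
Qed.

Lemma initial_ops_spec s (x0 : 'cV[R]_n) : constants s ->
  A^T *m dreg s 1 = x0 ->
  let s' := run_ops initial_ops s in
  let st := restart p x0 (psum p x0) in
  [/\ constants s', represents st s', sreg s' 24 = (finished p eps st)%:R &
      sreg s' 29 = (1 + eps) ^+ 2].
Proof.
move=> c hx s' st.
have xE i : \sum_k A k i * dreg s 1 k 0 = x0 i 0.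
  by rewrite -hx mxE; apply: eq_bigr => k _; rewrite mxE.
have pE : \sum_i (((\sum_k A k i * dreg s 1 k 0) * (\sum_k A k i * dreg s 1 k 0)) `^
    nreg s 4 i 0) `^ sreg s 0 = psum p x0.
  by apply: eq_bigr => i _; rewrite !xE (c_half c) sqr_powR_half (c_p c).
split; [exact: constants_run| | |].
- by split=> [i|i|i||]; evaluate; rewrite ?xE ?(c_start c) ?(c_0 c) ?pE ?mxE.
- by evaluate; rewrite !pE (c_eps c) (c_1eps c) /finished.
by evaluate; rewrite (c_1eps c) expr2.
Qed.

End Execution.

(** * Running the program *)

Section Loops.
Variables (R : realType) (d n : nat) (A : 'M[R]_(d, n)) (b : 'cV[R]_d).
Variable solve : forall m, 'M[R]_m -> 'cV[R]_m -> 'cV[R]_m.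
Variables (p eps : R) (xs : 'cV[R]_n).
Local Notation state := (state R n d).
Local Notation q := (inner_exp p n).
Local Notation T := (rounds n q).
Local Notation mu := (measure p eps xs).
Local Notation ok := (constants p eps).

Hypotheses (p2 : 2 <= p) (n0 : (0 < n)%N) (eps0 : 0 < eps).
Hypothesis solver : linear_solver solve.
Hypothesis xs_opt : forall x, A *m x = A *m xs -> psum p xs <= psum p x.
Hypothesis xs_gt0 : 0 < psum p xs.

Definition simulates st e (s : state) : Prop :=
  [/\ ok s, represents st s, iterate_inv A p xs st e &
      sreg s 24 = (finished p eps st)%:R].

Lemma iteration_exec st e s : simulates st e s ->
  exists t s' st' e', [/\ exec (sub_step A solve) iteration s t s',
    simulates st' e' s', mu st' e' + 1 <= mu st e, sreg s' 25 = sreg s 25 &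
    (count is_solve_call t <= 1)%N /\ (count is_sub_op t <= 99)%N].
Proof.
move=> [c r inv _].
have nu0 := ii_nu inv.
have u0 i : 0 < cur_weight p st i.
  apply: weight_gt0 => j; first exact: res_weight_ge0.
  exact: (inv_s_gt0 n0 (ii_inner inv)).
have [c1 r1 h25 h26 [h6 h3 h7]] := system_ops_spec A c r.
have e1 := exec_sub_block A solve system_ops s.
move: (run_ops A system_ops s) c1 r1 h25 h26 h6 h3 h7 e1 => s1 c1 r1 h25 h26 h6 h3 h7 e1.
pose phi := solve_call A solve (nreg s1 6) (nreg s1 7) (sreg s1 5).
pose s2 := set_d (set_s s1 30 (dsubmx phi 0 0)) 1 (usubmx phi).
have w0 i : 0 < nreg s1 7 i 0 by rewrite h7 mxE invr_gt0.
have e2 : exec (sub_step A solve) (Do (Solve 6 7 5 1 30)) s1 [:: SolveCall] s2.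
  apply: exec_Do; apply: step_Solve; first by move=> i; exact: ltW.
  by rewrite (c_1 c1) oner_eq0.
have c2 : ok s2 by apply: constants_frame c1 => [l l22|//]; rewrite /s2 /= /upd ltn_eqF// (leq_trans l22).
have r2 : represents st s2 by case: r1 => *; split.
set row := res_row p (it_nu st) (it_x st) in h6.
set u : 'cV[R]_n := \col_i _ in h3.
set v : 'cV[R]_n := \col_i _ in h7.
have [c3 r3 h25' h26' [h6' h3' h8]] := direction_ops_spec A c2 r2 h6 h3 h7 erefl erefl.
have e3 := exec_sub_block A solve (direction_ops ++ test_ops) s2.
have runE : run_ops A (direction_ops ++ test_ops) s2 =
    run_ops A test_ops (run_ops A direction_ops s2) by rewrite /run_ops foldl_cat.
rewrite {}runE in e3.
move: (run_ops A direction_ops s2) c3 r3 h25' h26' h6' h3' h8 e3 =>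
  s3 c3 r3 h25' h26' h6' h3' h8 e3.
set y : 'cV[R]_n := \col_i _ in h8.
have [c4 r4 h25'' h26'' [h8' h9 h31 h32 h33]] := test_ops_spec A c3 r3 h6' h3' h8.
move: (run_ops A test_ops s3) c4 r4 h25'' h26'' h8' h9 h31 h32 h33 e3 =>
  s4 c4 r4 h25'' h26'' h8' h9 h31 h32 h33 e3.
have uE : entries u = cur_weight p st by apply/funext => i; rewrite /entries mxE.
have g26 : sreg s4 26 = sigma p (it_nu st) by rewrite h26'' h26' -h26.
rewrite uE in h32.
have [t5 [s5 [e5 c5 r5 h25s [t5s t5o]]]] :=
  update_exec solve c4 r4 g26 h8' h9 h31 h32 h33.
have e6 := exec_sub_block A solve finished_ops s5.
have [c6 r6 h25f h24 _] := finished_ops_spec A c5 r5.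
move: (run_ops A finished_ops s5) c6 r6 h25f h24 e6 => s6 c6 r6 h25f h24 e6.
have uy i : cur_weight p st i * y i 0 =
    (A^T *m usubmx phi + dsubmx phi 0 0 *: row) i 0.
  by rewrite [y i 0]mxE [v i 0]mxE mulrA mulfV ?mul1r// gt_eqF.
have solved : (exists z, direction A row z) -> direction A row y.
  move=> [z zd]; have := @solve_call_direction R d n A row v z solve solver _ zd.
  rewrite /y -h6 -h7 /phi (c_1 c1); apply; exact: w0.
have [e' inv' dec] := next_iterate_inv p2 n0 eps0 xs_gt0 inv uy solved.
exists (nseq (size system_ops) SubOp ++ [:: SolveCall] ++
  nseq (size (direction_ops ++ test_ops)) SubOp ++ t5 ++ nseq (size finished_ops) SubOp),
  s6, (next_iterate A p st y), e'; split.
- by do 3?[apply: exec_Seq => //]; [exact: e1|exact: e2|exact: e3|exact: (exec_Seq e5 e6)].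
- by split.
- exact: dec.
- by rewrite h25f h25s h25'' h25' -h25.
rewrite !count_cat t5s !count_nseq; split => //=.
by rewrite !mul1n !add0n addnA addnC -addnA (leq_trans (leq_add t5o (leqnn _))).
Qed.

Lemma tick_spec st e s : simulates st e s ->
  let s' := run_ops A [:: SOp OpAdd 25 25 5] s in
  simulates st e s' /\ sreg s' 25 = sreg s 25 + 1.
Proof.
move=> [c r inv h24] s'; split; last by rewrite /s' /= /upd /= (c_1 c).
split => //; first exact: constants_run.
by case: r => *; split.
Qed.

(** A finished state idles, so the measure is claimed to decrease only if the run ends
    unfinished. *)
Lemma loop_exec m j st e s : simulates st e s -> sreg s 25 = j%:R ->
  (forall i, (i < m)%N -> (j + i)%:R <= T) -> T < (j + m)%:R ->
  exists t s' st' e', [/\ exec (sub_step A solve) (While 25 8 loop_body) s t s',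
    simulates st' e' s', finished p eps st -> finished p eps st',
    finished p eps st' \/ mu st' e' + m%:R <= mu st e &
    (count is_solve_call t <= m)%N /\ (count is_sub_op t <= 100 * m)%N].
Proof.
elim: m j st e s => [|m ih] j st e s sim h25 hlo hhi.
  exists [::], s, st, e; split => //; last by right; rewrite addr0.
  have [c _ _ _] := sim; apply: exec_WhileF.
  by rewrite (c_T c) h25 -[j]addn0.
have [c r inv h24] := sim.
have guard : sreg s 25 <= sreg s 8.
  by rewrite (c_T c) h25 -[j]addn0; exact: hlo.
have : exists t1 s1 st1 e1, [/\
    exec (sub_step A solve) (If 24 4 iteration (Skip _)) s t1 s1,
    simulates st1 e1 s1, sreg s1 25 = sreg s 25,
    (finished p eps st -> finished p eps st1) /\
    (finished p eps st \/ mu st1 e1 + 1 <= mu st e) &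
    (count is_solve_call t1 <= 1)%N /\ (count is_sub_op t1 <= 99)%N].
  case fin : (finished p eps st); rewrite fin in h24.
    exists [::], s, st, e; split => //; last by split=> //; left.
    by apply: exec_IfF; [rewrite h24 (c_0 c) ltr01|exact: exec_Skip].
  have [t1 [s1 [st1 [e1 [ex1 sim1 dec1 h251 cnt1]]]]] := iteration_exec sim.
  exists t1, s1, st1, e1; split => //; last by split=> //; right.
  by apply: exec_IfT ex1; rewrite h24 (c_0 c).
move=> [t1 [s1 [st1 [e1 [ex1 sim1 h251 [keep1 dec1] [sol1 op1]]]]]].
have [sim2 h252] := tick_spec sim1.
have ex2 := exec_sub_block A solve [:: SOp OpAdd 25 25 5] s1.
move: (run_ops A _ s1) sim2 h252 ex2 => s2 sim2 h252 ex2.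
have h25' : sreg s2 25 = j.+1%:R by rewrite h252 h251 h25 -natr1.
have [||t [s' [st' [e' [ex sim' keep dec [sol op]]]]]] := ih j.+1 st1 e1 s2 sim2 h25'.
- by move=> i im; rewrite addSnnS; exact: hlo.
- by rewrite addSnnS.
exists ((t1 ++ [:: SubOp]) ++ t), s', st', e'; split => //.
- by apply: exec_WhileT guard _ ex; exact: exec_Seq ex1 ex2.
- by move=> /keep1.
- case: dec => [|dec]; first by left.
  case: dec1 => [fin|dec1]; first by left; exact/keep/keep1.
  by right; apply: le_trans dec1; rewrite -natr1 addrA lerD2r.
rewrite !count_cat /= !addn0; split; first by rewrite -add1n leq_add.
by rewrite mulnS leq_add// -[100%N]/(99 + 1)%N leq_add2r.
Qed.

Definition steps : nat := Num.truncn T.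

Lemma steps_bounds : [/\ (0 < steps)%N, steps%:R <= T, T < (1 + steps)%:R & T <= 2 * steps%:R].
Proof.
have T1 : 1 <= T := rounds_ge1 (inner_exp_gt2 p2 n0) n0.
have T0 : 0 <= T by apply: le_trans T1.
have /andP[lo hi] := Num.Theory.truncn_itv T0.
have s0 : (0 < steps)%N by rewrite truncn_gt0.
rewrite -/steps in lo hi; split => //.
apply: (le_trans (ltW hi)); rewrite -natr1.
have : 1 <= steps%:R :> R by rewrite ler1n.
move: (steps%:R : R) => x; lra.
Qed.

Lemma subproblem_exec st e s : simulates st e s ->
  exists t s' st' e', [/\ exec (sub_step A solve) subproblem s t s',
    simulates st' e' s', finished p eps st' \/ mu st' e' + steps%:R <= mu st e,
    (count is_solve_call t)%:R <= T & (count is_sub_op t)%:R <= 101 * T].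
Proof.
move=> [c r inv h24]; have [m0 mT hi _] := steps_bounds.
have ex1 := exec_sub_block A solve [:: SConst 25 1] s.
have sim1 : simulates st e (run_ops A [:: SConst 25 1] s).
  by split => //; [exact: constants_run|case: r => *; split].
have h25 : sreg (run_ops A [:: SConst 25 1] s) 25 = 1%:R by [].
move: (run_ops A _ s) sim1 h25 ex1 => s1 sim1 h25 ex1.
have [|//|t [s' [st' [e' [ex sim' _ dec [sol op]]]]]] := @loop_exec steps 1 st e s1 sim1 h25.
  move=> i im; apply: le_trans mT; rewrite ler_nat; exact: im.
exists ([:: SubOp] ++ t), s', st', e'; split => //.
- exact: exec_Seq ex1 ex.
- by rewrite count_cat add0n; apply: le_trans mT; rewrite ler_nat.
rewrite count_cat /=; apply: (@le_trans _ _ (101 * steps%:R)).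
  rewrite -natrM ler_nat; apply: (leq_trans (leq_add (leqnn 1%N) op)).
  by rewrite -[101%N]/(1 + 100)%N mulnDl mul1n leq_add2r.
by rewrite ler_pM2l.
Qed.

(** N is fuel. At N = 0 an unfinished state would have negative measure. *)
Lemma main_loop_exec N st e s : simulates st e s ->
  finished p eps st \/ mu st e < N%:R * steps%:R ->
  exists t s' st' e', [/\
    exec (main_step A b solve) (While 24 4 (Do (Subproblem subproblem))) s t s',
    simulates st' e' s', finished p eps st', (size (subproblems t) <= N)%N &
    [/\ all (fun u => (count is_solve_call u)%:R <= T) (subproblems t),
     all (fun u => (count is_sub_op u)%:R <= 101 * T) (subproblems t),
     count is_main_op t = 0%N & count is_least_squares_call t = 0%N]].
Proof.
elim: N st e s => [|N ih] st e s sim; have [c r inv h24] := sim;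
  case fin : (finished p eps st); rewrite fin in h24.
- move=> _; exists [::], s, st, e; split => //.
  by apply: exec_WhileF; rewrite h24 (c_0 c).
- move=> [//|]; rewrite mul0r ltNge (measure_ge0 p2 n0 eps0 xs_opt xs_gt0 inv)//.
  by rewrite fin.
- move=> _; exists [::], s, st, e; split => //.
  by apply: exec_WhileF; rewrite h24 (c_0 c).
move=> [//|muN].
have [t1 [s1 [st1 [e1 [ex1 sim1 dec1 sol1 op1]]]]] := subproblem_exec sim.
have : finished p eps st1 \/ mu st1 e1 < N%:R * steps%:R.
  case: dec1 => [|dec1]; [by left|right].
  have arith (x y z w : R) : y + w <= x -> x < z + w -> y < z by lra.
  by apply: arith dec1 _; rewrite -[w in _ + w]mul1r -mulrDl natr1.
move=> /(ih st1 e1 s1 sim1)[t [s' [st' [e' [ex sim' fin' sz [al1 al2 cm cl]]]]]].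
exists ([:: SubRun t1] ++ t), s', st', e'; split => //=; last by rewrite sol1 op1.
rewrite -cat1s; apply: exec_WhileT ex; first by rewrite h24 (c_0 c).
by apply: exec_Do; exact: step_Subproblem.
Qed.

End Loops.

(** * Complexity bounds *)

Section Bounds.
Variables (R : realType) (n : nat) (p : R).
Local Notation q := (inner_exp p n).
Local Notation T := (rounds n q).
Local Notation L := (log_cap R n).

(** The exponent (q-2)/(3q-2) increases with q, which settles q <= p. If q > p, then q - 2 = 1/L and
    T <= n^(1/L) <= 4. *)
Lemma rounds_le : 2 <= p -> (0 < n)%N ->
  T <= 4 * n%:R `^ ((p - 2) / (3 * p - 2)).
Proof.
move=> p2 n0; have q2 := inner_exp_gt2 p2 n0; have n1 : 1 <= n%:R :> R by rewrite ler1n.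
have e0 : 1 <= n%:R `^ ((p - 2) / (3 * p - 2)) :> R.
  by rewrite -[leLHS](powRr0 n%:R) ler_powR// divr_ge0//; lra.
have [lq _ _ qc] := inner_exp_cases p2 n0.
have [qp|pq] := leP q p.
  apply: (@le_trans _ _ (n%:R `^ ((p - 2) / (3 * p - 2)))); last by rewrite ler_peMl//; lra.
  rewrite /rounds ler_powR// ler_pdivrMr; last lra.
  by rewrite mulrAC ler_pdivlMr; last lra; nra.
case: qc => [qE|[qp _]|[_ qE]]; [lra|lra|].
have l1 := log_cap_ge1 R n0.
have lV : 0 < L^-1 by rewrite invr_gt0; lra.
apply: (@le_trans _ _ 4); last by rewrite ler_peMr.
apply: le_trans (natr_powR_log_cap R n0); rewrite /rounds ler_powR//.
rewrite ler_pdivrMr; last lra.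
rewrite qE; have -> : 2 + L^-1 - 2 = L^-1 * 1 by ring.
by rewrite ler_pM2l//; lra.
Qed.

Lemma ln2_ge_half : 2^-1 <= ln (2 : R).
Proof. by rewrite -[leLHS](expRK (2^-1 : R)) ler_ln ?posrE ?expR_gt0// expR_half_le2. Qed.

(** The p-th power of the chain |x|_p <= |x|_2 <= |xs|_2 <= n^(1/2) |xs|_p. *)
Lemma sum_sqr_psum_le (x xs : 'cV[R]_n) : 2 <= p ->
  \sum_i x i 0 ^+ 2 <= \sum_i xs i 0 ^+ 2 -> psum p x <= n%:R `^ (p / 2) * psum p xs.
Proof.
move=> p2 h; have p0 : 0 < p by lra.
have ph : 0 <= p / 2 by lra.
have S0 (v : 'cV[R]_n) : 0 <= \sum_i v i 0 ^+ 2 by apply: sumr_ge0 => i _; exact: sqr_ge0.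
apply: le_trans (sum_powR_le_sqr xpredT (fun i => x i 0) p2) _.
apply: le_trans (powR_lerl ph (S0 x) h) _.
set M := psum p xs `^ p^-1.
have M0 : 0 <= M by exact: powR_ge0.
have : \sum_i xs i 0 ^+ 2 <= n%:R * M ^+ 2.
  apply: (@le_trans _ _ (\sum_(i < n) M ^+ 2)); last first.
    by rewrite sumr_const card_ord mulr_natl.
  apply: ler_sum => i _; rewrite -normr_sqr lerXn2r ?nnegrE//.
  exact: (norm_le_root_sum_powR (fun i => xs i 0) i p0).
move=> /(powR_lerl ph (S0 xs))/le_trans; apply.
rewrite powRM ?sqr_ge0// -(powR_sqr M0) -powRrM.
have -> : 2 * (p / 2) = p by lra.
by rewrite powR_inv_root// psum_ge0.
Qed.

Lemma lp_norm_le (x xs : 'cV[R]_n) (c : R) : 2 <= p -> 0 <= c ->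
  psum p x <= c `^ p * psum p xs -> lp_norm p x <= c * lp_norm p xs.
Proof.
move=> p2; have p0 : 0 < p by lra.
move=> c0 h; rewrite /lp_norm -/(psum p x) -/(psum p xs).
apply: le_trans (powR_lerl _ (psum_ge0 _ _) h) _; first by rewrite invr_ge0 ltW.
by rewrite powRM ?powR_ge0 ?psum_ge0// -powRrM mulfV ?gt_eqF// powRr1.
Qed.

Lemma powR_root_le (a b : R) : 0 < p -> 0 <= a -> 0 <= b ->
  a `^ p^-1 <= b `^ p^-1 -> a <= b.
Proof.
move=> p0 a0 b0 /(powR_lerl (ltW p0) (powR_ge0 _ _)).
by rewrite (powR_inv_root p0 a0) (powR_inv_root p0 b0).
Qed.

Lemma psum_lp_norm_le (x xs : 'cV[R]_n) : 2 <= p ->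
  lp_norm p x <= lp_norm p xs -> psum p x <= psum p xs.
Proof.
move=> p2; have p0 : 0 < p by lra.
exact: powR_root_le p0 (psum_ge0 p x) (psum_ge0 p xs).
Qed.

(** Bounding q and (q+1)/(q-2) separately would cost L^2. Since q (q+1)/(q-2) = q + 3 + 6/(q-2), a
    single factor L suffices. *)
Lemma work_rate : 2 <= p -> (0 < n)%N ->
  step_scale n p * (6 + 44 * ((q + 1) / (q - 2))) <= 10 ^+ 15 * p * L.
Proof.
move=> p2 n0; have q2 := inner_exp_gt2 p2 n0; have l1 := log_cap_ge1 R n0.
have [lq ql _ _] := inner_exp_cases p2 n0.
have lV : (q - 2)^-1 <= L.
  rewrite -[leRHS]invrK lef_pV2 ?posrE ?invr_gt0; lra.
have h : q * (6 + 44 * ((q + 1) / (q - 2))) <= 1000 * L.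
  have -> : q * (6 + 44 * ((q + 1) / (q - 2))) = 50 * q + 132 + 264 * (q - 2)^-1.
    by field; lra.
  lra.
rewrite /step_scale -mulrA.
have -> : 10 ^+ 15 * p * L = 10 ^+ 12 * p * (1000 * L) by rewrite !exprS expr0; ring.
by apply: ler_wpM2l h; rewrite mulr_ge0 ?exprn_ge0//; lra.
Qed.

(** As T >= 1, T + 2 <= 3 T, and T <= 2 [steps]: this gives 6 = 3 * 2 and 44 = 22 * 2. *)
Lemma steps_rate : 2 <= p -> (0 < n)%N ->
  solve_budget n p <= (steps n p)%:R * (6 + 44 * ((q + 1) / (q - 2))).
Proof.
move=> p2 n0; have q2 := inner_exp_gt2 p2 n0; have T1 := rounds_ge1 q2 n0.
have [_ _ _ Tm] := steps_bounds p2 n0.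
have r0 : 0 <= (q + 1) / (q - 2) by rewrite divr_ge0//; lra.
have -> : solve_budget n p = T + 2 + 22 * ((q + 1) / (q - 2)) * T.
  rewrite /solve_budget /min_gain; field; apply/and3P; split; lra.
move: r0 Tm; move: ((q + 1) / (q - 2)) (steps n p)%:R => r m r0 Tm.
nra.
Qed.

End Bounds.

(** * The number of subproblems *)

Section Counting.
Variables (R : realType) (d n : nat) (A : 'M[R]_(d, n)) (p eps : R) (x0 xs : 'cV[R]_n).
Local Notation q := (inner_exp p n).
Local Notation L := (log_cap R n).
Local Notation Y := (ln (n%:R / eps)).

(** The failed early exit gives n >= 2 and eps^2 <= n, so a large eps cannot make ln (n/eps)
    negligible compared with ln n. *)
Lemma log_facts : 0 < eps -> (1 + eps) ^+ 2 < n%:R :> R ->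
  [/\ 2^-1 <= ln n%:R :> R, ln n%:R <= 2 * Y & L <= 3 * ln n%:R].
Proof.
move=> eps0 neps.
have n1 : 1 < n%:R :> R.
  by apply: le_lt_trans neps; rewrite expr2; nra.
have nR : 0 < n%:R :> R by lra.
have n2 : 2 <= n%:R :> R by rewrite ler_nat; move: n1; rewrite ltr1n.
have lnn : 2^-1 <= ln n%:R :> R.
  by apply: le_trans (ln2_ge_half R) _; rewrite ler_ln ?posrE.
split => //; last by rewrite /log_cap; lra.
have ne0 : 0 < n%:R / eps by rewrite divr_gt0.
have -> : 2 * Y = ln ((n%:R / eps) ^+ 2).
  by rewrite expr2 (@lnM R (n%:R / eps)) ?posrE//; ring.
rewrite ler_ln ?posrE ?exprn_gt0//.
have e2 : eps ^+ 2 <= n%:R by apply: le_trans (ltW neps); rewrite !expr2; nra.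
rewrite exprMn exprVn ler_pdivlMr ?exprn_gt0// expr2.
by apply: ler_wpM2l => //; exact: ltW.
Qed.

Lemma count_arith (a l y lam rate l2 m : R) : 0 <= a -> 0 <= l -> 0 <= y ->
  1 <= lam -> 6 <= rate -> 0 <= l2 -> l2 + 1 <= 6 * (a * y) ->
  lam * rate <= 3 * 10 ^+ 15 * (a * l) -> m <= rate * (6 * lam * (l2 + 1)) ->
  m + 1 <= 10 ^+ 18 * (a ^+ 2 * l * y).
Proof.
move=> a0 l0 y0 lam1 rate6 l20 l2y lr mle.
have key : lam * rate * (l2 + 1) <= 3 * 10 ^+ 15 * (a * l) * (6 * (a * y)).
  by apply: ler_pM => //; [rewrite mulr_ge0//; lra|lra].
have one : 1 <= lam * rate * (l2 + 1).
  have lr6 : 1 * 6 <= lam * rate by apply: ler_pM.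
  have : 6 * 1 <= lam * rate * (l2 + 1) by apply: ler_pM => //; lra.
  lra.
have -> : 10 ^+ 18 * (a ^+ 2 * l * y) = 1000 * (10 ^+ 15 * (a * l * (a * y))).
  by rewrite !exprS expr0; ring.
have mE : rate * (6 * lam * (l2 + 1)) = 6 * (lam * rate * (l2 + 1)) by ring.
have t0 : 0 <= 10 ^+ 15 * (a * l * (a * y)) by rewrite !mulr_ge0 ?exprn_ge0.
have keyE : 3 * 10 ^+ 15 * (a * l) * (6 * (a * y)) =
   18 * (10 ^+ 15 * (a * l * (a * y))) by ring.
rewrite mE in mle; rewrite keyE in key.
move: (10 ^+ 15 * _) (lam * rate * _) key one mle t0 => c e key one mle t0.
lra.
Qed.

Lemma measure_start_le : 2 <= p -> 0 < eps -> (1 + eps) ^+ 2 < n%:R ->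
  0 < psum p xs -> psum p xs <= psum p x0 -> psum p x0 <= n%:R `^ (p / 2) * psum p xs ->
  measure p eps xs (restart p x0 (psum p x0)) 0 / (steps n p)%:R + 1 <=
  10 ^+ 18 * (p ^+ 2 * ln n%:R * Y).
Proof.
move=> p2 eps0 neps xs0 x0s x0n.
have n0 : (0 < n)%N.
  rewrite -(ltr0n R); apply: lt_trans neps; rewrite exprn_gt0//; lra.
have nR : 0 < n%:R :> R by rewrite ltr0n.
have q2 := inner_exp_gt2 p2 n0; have T1 := rounds_ge1 q2 n0.
have [lnn lnY Ln] := log_facts eps0 neps.
have [m0 _ _ _] := steps_bounds p2 n0.
have ln2 : 2^-1 <= ln 2 :> R := ln2_ge_half R.
have g0 := gain_gt0 p2 n0.
have lam1 : 1 <= step_scale n p.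
  rewrite /step_scale -mulrA; apply: (@le_trans _ _ (10 ^+ 12 * 1)).
    by rewrite mulr1 !exprS expr0; lra.
  by apply: ler_wpM2l; [rewrite exprn_ge0|nra].
set lam := step_scale n p in lam1.
set B := solve_budget n p.
have B1 : rounds n q + 1 + 11 / min_gain n q <= B by rewrite /B /solve_budget; lra.
have B0 : 0 <= B.
  apply: le_trans B1; have := divr_ge0 (ltac:(lra) : 0 <= 11 :> R) (ltW g0); lra.
set num := eps * psum p xs / (1 + eps).
have num0 : 0 < num by rewrite !mulr_gt0// invr_gt0; lra.
have x00 : 0 < psum p x0 by apply: lt_le_trans x0s.
set l2 := ln (psum p x0 / num) / ln 2.
have Y0 : 0 < Y by lra.
have l20 : 0 <= l2.
  rewrite divr_ge0//; last lra.
  rewrite ln_ge0// ler_pdivlMr// mul1r /num ler_pdivrMr; last lra.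
  have := mulr_gt0 eps0 xs0; nra.
have l2Y : l2 <= 4 * p * Y.
  (* The least-squares start contributes n^(p/2), and 1 + eps <= n turns (1 + eps)/eps into n/eps.
     The exponent p/2 is the second source of p in the bound. *)
  have : ln (psum p x0 / num) <= p / 2 * ln n%:R + Y.
    have r0 : 0 < psum p x0 / num by apply: divr_gt0.
    have ne0 : 0 < n%:R / eps by apply: divr_gt0.
    have np0 : 0 < n%:R `^ (p / 2) by apply: powR_gt0.
    rewrite -ln_powR -lnM ?posrE// ler_ln ?posrE//; last by apply: mulr_gt0.
    rewrite ler_pdivrMr//; apply: le_trans x0n _.
    have -> : n%:R `^ (p / 2) * (n%:R / eps) * num =
        n%:R `^ (p / 2) * psum p xs * (n%:R / (1 + eps)).
      by rewrite /num; field; apply/andP; split; lra.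
    rewrite ler_peMr ?mulr_ge0 ?powR_ge0 ?(ltW xs0)// ler_pdivlMr; last lra.
    by apply: le_trans (ltW neps); rewrite mul1r expr2; nra.
  move=> h; rewrite /l2 ler_pdivrMr; last lra.
  have : p * ln n%:R <= p * (2 * Y) by apply: ler_wpM2l => //; lra.
  have pY : 2 * Y <= p * Y by rewrite ler_pM2r.
  have : 4 * p * Y * 2^-1 <= 4 * p * Y * ln 2.
    by apply: ler_wpM2l => //; rewrite !mulr_ge0//; lra.
  nra.
have pY : 2^-1 <= p * Y by nra.
set ref := refinements p eps xs x0 (psum p x0).
have refle : ref + 1 <= 6 * lam * (l2 + 1).
  rewrite /ref /refinements -/lam -/num -/l2.
  have gapn : (psum p x0 - psum p xs) / psum p x0 <= 1 by rewrite ler_pdivrMr//; lra.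
  have : 4 * lam * ((psum p x0 - psum p xs) / psum p x0) <= 4 * lam * 1.
    by apply: ler_wpM2l => //; lra.
  have : 0 <= lam * l2 by rewrite mulr_ge0//; lra.
  have : l2 <= lam * l2 by rewrite ler_peMl.
  nra.
set rate := 6 + 44 * ((q + 1) / (q - 2)).
have rate0 : 6 <= rate.
  have : 0 <= (q + 1) / (q - 2) by rewrite divr_ge0//; lra.
  by rewrite /rate; lra.
have mR : 0 < (steps n p)%:R :> R by rewrite ltr0n.
have muB : measure p eps xs (restart p x0 (psum p x0)) 0 <= B * (ref + 1).
  rewrite /measure /= -/B -/ref subr0 max_r; last by rewrite subr0.
  have -> : B * (ref + 1) = B * ref + B by ring.
  by rewrite !subr0 -[X in X <= _]addrA lerD2l.
have mum : measure p eps xs (restart p x0 (psum p x0)) 0 / (steps n p)%:R <=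
    rate * (6 * lam * (l2 + 1)).
  rewrite ler_pdivrMr//; apply: le_trans muB _.
  have Br := steps_rate p2 n0; rewrite -/B -/rate in Br.
  apply: (@le_trans _ _ (B * (6 * lam * (l2 + 1)))); first exact: ler_wpM2l.
  have -> : rate * (6 * lam * (l2 + 1)) * (steps n p)%:R =
    (steps n p)%:R * rate * (6 * lam * (l2 + 1)) by ring.
  by apply: ler_wpM2r => //; rewrite !mulr_ge0//; lra.
have wr := work_rate p2 n0; rewrite -/lam -/rate in wr.
move: (measure _ _ _ _ _ / _) mum => mm mum.
have l6 : l2 + 1 <= 6 * (p * Y) by lra.
have lr : lam * rate <= 3 * 10 ^+ 15 * (p * ln n%:R).
  apply: le_trans wr _.
  have -> : 3 * 10 ^+ 15 * (p * ln n%:R) = 10 ^+ 15 * p * (3 * ln n%:R) :> R by ring.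
  by apply: ler_wpM2l => //; rewrite mulr_ge0 ?exprn_ge0//; lra.
apply: (@count_arith p (ln n%:R) Y lam rate l2) => //; lra.
Qed.

End Counting.

(** * The theorem *)

Section Run.
Variables (R : realType) (d n : nat) (A : 'M[R]_(d, n)) (b : 'cV[R]_d).
Variable solve : forall m, 'M[R]_m -> 'cV[R]_m -> 'cV[R]_m.
Variables (p eps : R).
Local Notation x0 := (A^T *m solve (A *m A^T) b).
Local Notation start := (restart p x0 (psum p x0)).
Local Notation main_while := (While 24 4 (Do (Subproblem subproblem))).

Lemma preamble_exec : exists t s, [/\
  forall t' s', exec (main_step A b solve) (If 2 29 (Skip _) main_while) s t' s' ->
    exec (main_step A b solve) regression (initial_state n b p eps) (t ++ t') s',
  [/\ constants p eps s, represents start s, sreg s 24 = (finished p eps start)%:R &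
      sreg s 29 = (1 + eps) ^+ 2], subproblems t = [::],
  (count is_main_op t <= 100)%N & count is_least_squares_call t = 1%N].
Proof.
have [h0 h1 h2 h4 [h5 h6 h14 h19 [h18 h7]]] := constant_ops_spec A (erefl (initial_state n b p eps)).
have c1 := parameter_ops_spec A h0 h1 h2 h4 h5 h6 h14 h19 h18 h7.
have e1 := exec_main_block A b solve (constant_ops ++ parameter_ops) (initial_state n b p eps).
have runE : run_ops A (constant_ops ++ parameter_ops) (initial_state n b p eps) =
    run_ops A parameter_ops (run_ops A constant_ops (initial_state n b p eps)).
  by rewrite /run_ops foldl_cat.
rewrite {}runE in e1.
move: (run_ops A parameter_ops _) c1 e1 => s1 c1 e1.
pose s2 := set_d s1 1 (solve (A *m A^T) b).
have e2 : exec (main_step A b solve) (Do (LeastSquares 1)) s1 [:: LeastSquaresCall] s2.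
  by apply: exec_Do; exact: step_LeastSquares.
have c2 : constants p eps s2 by apply: constants_frame c1.
have [c3 r3 h24 h29] := initial_ops_spec c2 (erefl (A^T *m dreg s2 1)).
have e3 := exec_main_block A b solve initial_ops s2.
move: (run_ops A initial_ops s2) c3 r3 h24 h29 e3 => s3 c3 r3 h24 h29 e3.
exists (nseq (size (constant_ops ++ parameter_ops)) MainOp ++ [:: LeastSquaresCall] ++
        nseq (size initial_ops) MainOp), s3; split => //.
move=> t' s' ex; rewrite -!catA.
exact: exec_Seq e1 (exec_Seq e2 (exec_Seq e3 ex)).
Qed.

Hypotheses (p2 : 2 <= p) (n0 : (0 < n)%N) (eps0 : 0 < eps).
Hypotheses (span : in_col_span A b) (solver : linear_solver solve).

Lemma represents_x st (s : state R n d) : represents st s -> nreg s 0 = it_x st.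
Proof. by move=> r; apply/matrixP => i j; rewrite (ord1 j) (r_x r). Qed.

Lemma finished_approx st xs : lp_optimal p A b xs ->
  A *m it_x st = A *m xs -> psum p (it_x st) - psum p xs <= it_nu st ->
  finished p eps st -> lp_approx_solution p eps A b (it_x st).
Proof.
move=> opt Ax gap fin; split; first by rewrite Ax; case: opt.
exists xs => //; have e1 : 0 <= 1 + eps by have := eps0; lra.
apply: lp_norm_le => //.
have : psum p (it_x st) <= (1 + eps) * psum p xs.
  move: gap fin; rewrite /finished; have := eps0.
  move: (psum p (it_x st)) (psum p xs) (it_nu st) => a c nu eps1 gap fin.
  have : (a - c) * (1 + eps) <= nu * (1 + eps) by apply: ler_wpM2r; lra.
  lra.
move=> /le_trans; apply; apply: ler_wpM2r; first exact: psum_ge0.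
by apply: le1r_powR; have := p2; have := eps0; lra.
Qed.

Lemma regression_correct :
  exists (t : seq main_event) (x : 'cV[R]_n),
    [/\ run A b solve p eps regression t x, lp_approx_solution p eps A b x,
        (size (subproblems t))%:R
          <= 10 ^+ 18 * (p ^+ 2 * ln n%:R * Num.max 0 (ln (n%:R / eps))),
        all (fun u => (count is_solve_call u)%:R <= rounds n (inner_exp p n))
          (subproblems t) &
        [/\ all (fun u => (count is_sub_op u)%:R <= 101 * rounds n (inner_exp p n))
          (subproblems t), (count is_main_op t <= 100)%N &
          (count is_least_squares_call t <= 1)%N]].
Proof.
have [xs opt] := lp_optimal_exists p2 span.
have [Ax0 x0min] := least_squares_min solver span.
have [Axs xsmin] := opt.
have psmin x : A *m x = A *m xs -> psum p xs <= psum p x.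
  by move=> Ax; exact: psum_lp_norm_le p2 (xsmin x (etrans Ax Axs)).
have x0n : psum p x0 <= n%:R `^ (p / 2) * psum p xs.
  by apply: sum_sqr_psum_le => //; exact: x0min.
have x0s : psum p xs <= psum p x0 by apply: psmin; rewrite Ax0.
have bound0 : 0 <= 10 ^+ 18 * (p ^+ 2 * ln n%:R * Num.max 0 (ln (n%:R / eps))).
  rewrite mulr_ge0 ?exprn_ge0// mulr_ge0//; last by rewrite le_max lexx.
  by rewrite mulr_ge0 ?sqr_ge0// ln_ge0// ler1n.
have [t0 [s0 [cont [c r h24 h29] sub0 main0 ls0]]] := preamble_exec.
have [small|large] := leP n%:R ((1 + eps) ^+ 2).
  exists (t0 ++ [::]), x0; rewrite cats0 sub0; split => //.
  - exists s0; last by rewrite (represents_x r).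
    rewrite -[t0]cats0; apply: cont; apply: exec_IfT; last exact: exec_Skip.
    by rewrite (c_n c) h29.
  - split => //; exists xs => //; apply: lp_norm_le => //; first by have := eps0; lra.
    apply: le_trans x0n _; apply: ler_wpM2r; first exact: psum_ge0.
    have -> : (1 + eps) `^ p = ((1 + eps) ^+ 2) `^ (p / 2).
      rewrite -powR_sqr; last by have := eps0; lra.
      by rewrite -powRrM mulrC divfK// pnatr_eq0.
    by apply: powR_lerl => //; have := p2; lra.
  - by rewrite ls0.
have guard : sreg s0 29 < sreg s0 2 by rewrite (c_n c) h29.
case fin : (finished p eps start); rewrite fin in h24.
  exists (t0 ++ [::]), x0; rewrite cats0 sub0; split => //.
  - exists s0; last by rewrite (represents_x r).
    rewrite -[t0]cats0; apply: cont; apply: exec_IfF => //; apply: exec_WhileF.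
    by rewrite h24 (c_0 c).
  - apply: (finished_approx opt _ _ fin) => /=; first by rewrite Ax0.
    by rewrite lerBlDr lerDl psum_ge0.
  - by rewrite ls0.
(* If the optimum were 0, the least-squares point would attain it and pass the stopping test, a case
   already handled. *)
have xs0 : 0 < psum p xs.
  rewrite lt_neqAle psum_ge0 andbT; apply/eqP => xs0.
  move: fin; rewrite /finished /= (_ : psum p x0 = 0) ?mul0r ?mulr0 ?lexx//.
  by apply/eqP; rewrite eq_le psum_ge0 andbT; move: x0n; rewrite -xs0 mulr0.
have nu0 : 0 < psum p x0 := lt_le_trans xs0 x0s.
have T1 := rounds_ge1 (inner_exp_gt2 p2 n0) n0.
have inv : iterate_inv A p xs start 0.
  split => //=; [by rewrite Ax0|by rewrite lerBlDr lerDl psum_ge0|exact: le_trans T1|].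
  exact: start_inv.
have sim : simulates A p eps xs start 0 s0 by split => //; rewrite h24 fin.
have [m0 _ _ _] := steps_bounds p2 n0.
have mR : 0 < (steps n p)%:R :> R by rewrite ltr0n.
set mu := measure p eps xs start 0.
have mu0 : 0 <= mu by apply: (measure_ge0 p2 n0 eps0 psmin xs0 inv); rewrite fin.
have mm0 : 0 <= mu / (steps n p)%:R by rewrite divr_ge0// ltW.
(* At most floor (mu / [steps]) + 1 subproblems run; this accounts for the + 1 in
   [measure_start_le]. *)
have /andP[tlo thi] := Num.Theory.truncn_itv mm0.
have muN : mu < (Num.truncn (mu / (steps n p)%:R)).+1%:R * (steps n p)%:R.
  by rewrite -ltr_pdivrMr.
have [t [s [st [e [ex sim' fin' sz [al1 al2 cm cl]]]]]] :=
  main_loop_exec b p2 n0 eps0 solver psmin xs0 sim (or_intror muN).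
have [c' r' inv' _] := sim'.
have subE : subproblems (t0 ++ t) = subproblems t.
  by rewrite /subproblems pmap_cat -/(subproblems t0) sub0.
exists (t0 ++ t), (it_x st); rewrite subE; split => //.
- exists s; last exact: represents_x r'.
  by apply: cont; apply: exec_IfF ex.
- exact: (finished_approx opt (ii_A inv') (ii_gap inv') fin').
- have [_ lnY _] := log_facts eps0 large.
  rewrite max_r; last first.
    have : 0 <= ln n%:R :> R by rewrite ln_ge0// ler1n.
    by move: lnY; move: (ln _) (ln _) => a c''; lra.
  apply: le_trans (measure_start_le p2 eps0 large xs0 x0s x0n).
  apply: (@le_trans _ _ (Num.truncn (mu / (steps n p)%:R)).+1%:R); first by rewrite ler_nat.
  by rewrite -natr1 lerD2r.
by rewrite !count_cat cm cl addn0 ls0.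
Qed.

End Run.

Theorem theorem4 (R : realType) :
  exists2 C : R, 0 < C &
  forall p : R, 2 <= p ->
  exists alg : algorithm,
  forall (d n : nat) (A : 'M[R]_(d, n)) (b : 'cV[R]_d) (eps : R)
         (solve : forall m : nat, 'M[R]_m -> 'cV[R]_m -> 'cV[R]_m),
    (0 < n)%N -> in_col_span A b -> 0 < eps -> linear_solver solve ->
  exists (t : seq main_event) (x : 'cV[R]_n),
    [/\ run A b solve p eps alg t x,
        lp_approx_solution p eps A b x,
        (size (subproblems t))%:R
          <= C * (p ^+ 2 * ln n%:R * Num.max 0 (ln (n%:R / eps))),
        all (fun u : seq sub_event =>
               (count is_solve_call u)%:R
                 <= C * n%:R `^ ((p - 2) / (3 * p - 2))) (subproblems t) &
        (* work other than the linear system solves of the subproblems *)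
        [/\ all (fun u : seq sub_event =>
                   (count is_sub_op u)%:R
                     <= C * n%:R `^ ((p - 2) / (3 * p - 2))) (subproblems t),
            (count is_main_op t)%:R <= C * (1 + (size (subproblems t))%:R) &
            (count is_least_squares_call t <= 1)%N]].
Proof.
exists (10 ^+ 18); first exact: exprn_gt0.
move=> p p2; exists regression => d n A b eps solve n0 span eps0 solver.
have [t [x [hrun happ hsz hsol [hop hmain hls]]]] :=
  regression_correct p2 n0 eps0 span solver.
have T4 := rounds_le p2 n0.
have C1000 : 1000 <= 10 ^+ 18 :> R.
  have -> : 1000 = 10 ^+ 3 :> R by rewrite !exprS expr0; ring.
  by rewrite ler_weXn2l// ler1n.
set N := n%:R `^ _ in T4 *; have N0 : 0 <= N by exact: powR_ge0.
have T404 : 101 * rounds n (inner_exp p n) <= 10 ^+ 18 * N.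
  apply: (@le_trans _ _ (1000 * N)); last exact: ler_wpM2r.
  by move: T4; move: (rounds _ _) => T T4; lra.
have T0 : 0 <= rounds n (inner_exp p n) by exact: powR_ge0.
exists t, x; split => //.
  by apply: sub_all hsol => u /le_trans; apply; apply: le_trans T404; rewrite ler_peMl// ler1n.
split => //; first by apply: sub_all hop => u /le_trans; apply.
apply: (@le_trans _ _ 100%:R); first by rewrite ler_nat.
apply: (@le_trans _ _ (10 ^+ 18 * 1)); first by rewrite mulr1; apply: le_trans C1000; rewrite ler_nat.
by apply: ler_wpM2l; [exact: exprn_ge0|rewrite lerDl].
Qed.
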